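(* For $\omega\in\mathbb R$ let $\beta(\omega):=(1+|\omega|)^{-1}$. For $\psi,\varphi\in L^2(\mathbb R)$ define on $\mathbb R^2$, equipped with Lebesgue measure $dx\,d\omega$, the maps $$\Psi(x,\omega):=M_{\omega}T_xD_{\beta(\omega)}\psi,\qquad \Phi(x,\omega):=M_{\omega}T_xD_{\beta(\omega)}\varphi .$$ There are no $\psi,\varphi\in L^2(\mathbb R)$ such that all of the following hold: $(\Psi,\Phi)$ is a reproducing pair for $L^2(\mathbb R)$; $$\int_{\mathbb R}\big|\hat\psi\big(\beta(\omega)(\xi-\omega)\big)\,\hat\varphi\big(\beta(\omega)(\xi-\omega)\big)\big|\,\beta(\omega)\,d\omega<\infty\quad\text{for a.e. }\xi\in\mathbb R;$$ and the resolution operator satisfies $S_{\Psi,\Phi}=\mathrm{Id}$.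
   Context: For $f\in L^2(\mathbb R)$: $T_xf(t)=f(t-x)$, $M_\omega f(t)=e^{2\pi i\omega t}f(t)$, $D_af(t)=|a|^{-1/2}f(t/a)$, and $\hat f(\xi)=\int_{\mathbb R}f(t)e^{-2\pi i t\xi}\,dt$ (extended unitarily to $L^2(\mathbb R)$). Inner products are linear in the first argument. A pair $(\Psi,\Phi)$ of weakly measurable maps from a measure space $X$ to a Hilbert space $\mathcal H$ is a reproducing pair for $\mathcal H$ if the resolution operator $S_{\Psi,\Phi}f:=\int_X\langle f,\Psi\rangle\Phi$ (defined weakly) is a bounded linear operator on $\mathcal H$ with bounded inverse defined on all of $\mathcal H$. In the present setting ''weakly'' means that $S_{\Psi,\Phi}$ is the bounded operator on $L^2(\mathbb R)$ determined by $$\langle S_{\Psi,\Phi}f_1,f_2\rangle=\int_{\mathbb R}\Big(\int_{\mathbb R}\langle f_1,\Psi(x,\omega)\rangle\overline{\langle f_2,\Phi(x,\omega)\rangle}\,dx\Big)d\omega$$ for all $f_1,f_2\in L^1(\mathbb R)\cap L^2(\mathbb R)$, extended by density. *)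

(* Defs.v *)
From HB Require Import structures.
From mathcomp Require Export all_boot all_order all_algebra.
From mathcomp Require Export all_classical all_reals all_analysis.
From mathcomp Require Export complex.

Set Implicit Arguments.
Unset Strict Implicit.
Unset Printing Implicit Defensive.

Export Order.TTheory GRing.Theory Num.Theory.
Export numFieldNormedType.Exports.

Local Open Scope classical_set_scope.
Local Open Scope ring_scope.
Local Open Scope complex_scope.

(* Elements of L^2(R) are represented by functions R -> R[i]; equality in
   L^2(R) is almost-everywhere equality [aeeq]. *)

Section Lebesgue_spaces.
Context {R : realType}.
Implicit Types f g : R -> R[i].

Local Notation mu := (@lebesgue_measure R).

Definition aeeq f g : Prop := {ae mu, forall t, f t = g t}.

Definition cmeasurable d (T : measurableType d) (F : T -> R[i]) : Prop :=
  measurable_fun [set: T] (fun p => complex.Re (F p)) /\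
  measurable_fun [set: T] (fun p => complex.Im (F p)).

Definition cnorm (p : R) f : \bar R :=
  'N[mu]_(p%:E)[EFin \o (fun t => Normc.normc (f t))].

Definition cdist (p : R) f g : \bar R := cnorm p (fun t => f t - g t).

Definition cLp (p : R) : set (R -> R[i]) :=
  [set f | cmeasurable f /\ (cnorm p f < +oo)%E].

Definition cintegrable f : Prop :=
  mu.-integrable [set: R] (fun t => (complex.Re (f t))%:E) /\
  mu.-integrable [set: R] (fun t => (complex.Im (f t))%:E).

Definition cintegral f : R[i] :=
  (\int[mu]_t complex.Re (f t)) +i* (\int[mu]_t complex.Im (f t)).

Definition inner f g : R[i] := cintegral (fun t => f t * (g t)^*).

End Lebesgue_spaces.

Section Time_frequency.
Context {R : realType}.
Implicit Types f g : R -> R[i].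

Definition expi (theta : R) : R[i] := cos theta +i* sin theta.

Definition translation (x : R) f : R -> R[i] := fun t => f (t - x).

Definition modulation (w : R) f : R -> R[i] :=
  fun t => expi (2 * pi * w * t) * f t.

Definition dilation (a : R) f : R -> R[i] :=
  fun t => (`|a| `^ (- 2^-1))%:C * f (t / a).

Definition fourier1 f : R -> R[i] :=
  fun xi => cintegral (fun t => f t * expi (- (2 * pi * t * xi))).

(* [g] is (a version of) the Fourier transform of [f] in L^2(R): the graph of
   the unitary extension is the L^2 x L^2 closure of the graph of the integral
   transform on the intersection of L^1 and L^2. *)
Definition is_fourier2 f g : Prop :=
  [/\ cLp 2 f, cLp 2 g &
      forall e : R, 0 < e -> exists h : R -> R[i],
        [/\ cLp 1 h, cLp 2 h,
            (cdist 2 f h < e%:E)%E &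
            (cdist 2 g (fourier1 h) < e%:E)%E]].

End Time_frequency.

Section Reproducing_pairs.
Context {R : realType}.
Implicit Types (f g : R -> R[i]) (S T : (R -> R[i]) -> (R -> R[i])).
Implicit Types Psi Phi : R -> R -> R -> R[i].

Local Notation mu := (@lebesgue_measure R).

(* Linearity is required up to a.e. equality; together with the norm bound it
   makes [S] compatible with a.e. equality, so that it descends to L^2(R). *)
Definition bounded_operator S : Prop :=
  [/\ forall f, cLp 2 f -> cLp 2 (S f),
      forall (a b : R[i]) f g, cLp 2 f -> cLp 2 g ->
        aeeq (S (fun t => a * f t + b * g t)) (fun t => a * S f t + b * S g t) &
      exists C : R, forall f, cLp 2 f -> (cnorm 2 (S f) <= C%:E * cnorm 2 f)%E].

Definition has_bounded_inverse S : Prop :=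
  exists T, [/\ bounded_operator T,
    forall f, cLp 2 f -> aeeq (T (S f)) f &
    forall f, cLp 2 f -> aeeq (S (T f)) f].

Definition weakly_measurable Psi : Prop :=
  forall f, cLp 2 f -> cmeasurable (fun p : R * R => inner f (Psi p.1 p.2)).

(* [S] is the resolution operator of (Psi, Phi).  Integrals of non-integrable
   functions have a default value, hence the explicit integrability clauses. *)
Definition is_resolution_operator Psi Phi S : Prop :=
  bounded_operator S /\
  forall f1 f2, cLp 1 f1 -> cLp 2 f1 -> cLp 1 f2 -> cLp 2 f2 ->
    let F w x := inner f1 (Psi x w) * (inner f2 (Phi x w))^* in
    [/\ {ae mu, forall w, cintegrable (F w)},
        cintegrable (fun w => cintegral (F w)) &
        inner (S f1) f2 = cintegral (fun w => cintegral (F w))].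

Definition reproducing_pair Psi Phi : Prop :=
  [/\ weakly_measurable Psi, weakly_measurable Phi &
      exists S, is_resolution_operator Psi Phi S /\ has_bounded_inverse S].

End Reproducing_pairs.

Section Flexible_Gabor_system.
Context {R : realType}.

Definition beta (w : R) : R := (1 + `|w|)^-1.

Definition atom (psi : R -> R[i]) (x w : R) : R -> R[i] :=
  modulation w (translation x (dilation (beta w) psi)).

End Flexible_Gabor_system.

(* Main.v *)
Require Import Defs.
From mathcomp Require Import ring lra measurable_realfun.

(* By Plancherel, the resolution operator is the Fourier multiplier with symbol
   m(xi) = int_w h(beta(w)(xi - w)) beta(w) dw, where h = conj(psihat) * phihat.
   For fixed z the equation z = beta(w)(xi - w) is affine in (w, xi) on each of
   the half-lines w >= 0 and w < 0, so that m(xi) = int_z h(z) D(z, xi) dz for an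
   explicit weight D whose only jump in xi is at xi = z, of height
   1/(1+z) + 1/(z-1).  If m = 1, Lebesgue differentiation in xi yields
   h(z) (1/(1+z) + 1/(z-1)) = 0 almost everywhere, hence h = 0 and m = 0.

   Only one Fourier pair, e^(-k|y|) and its Poisson kernel, is used as a test
   function: with p the transform of P = e^(-k|.|), q = e^(-|.|/k) and Q the
   transform of q, the resolution identity tested on the modulations by a of p
   and q reads int m(a + y) P(y) Q(y) dy = int p q, and P Q is an approximate
   identity up to a constant as k tends to infinity.  Plancherel for general
   psi and phi is replaced by Fubini for integrable functions followed by an L^2
   limit, along the approximations provided by [is_fourier2]. *)


Set Implicit Arguments.
Unset Strict Implicit.
Unset Printing Implicit Defensive.

Local Open Scope classical_set_scope.
Local Open Scope ring_scope.
Local Open Scope complex_scope.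

(** * Affine changes of variables and Fubini *)

Section affine.
Context {R : realType}.
Local Notation mu := (@lebesgue_measure R).

(** The obstruction is the kink of [beta] at 0. For a constant dilation the density of the solutions
    [xi] at fixed [z] would be 1, and the multiplier a constant, which can be 1. Here the half-lines
    [w >= 0] and [w < 0] are mapped with slopes [1 + z] and [1 - z] onto rays that both start at
    [z], and the two densities do not match there: the jump equals 2z / (z^2 - 1), which vanishes at
    [z = 0] only. These densities are unbounded near [z = 1] and [z = -1], so an exchange of
    integrals needs [h] to be integrable against them. The almost everywhere finiteness of the
    integral over [w] provides this, through one point [xi] on each side of [[-2, 2]]. The weight is
    locally constant in [xi] away from [z], so the averages converge at every [a], without an
    exceptional set. The argument is carried out for the real part of [h], since the value 1 to be
    contradicted is real. *)

Definition affine (b c : R) (x : R) := b * x + c.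

Lemma measurable_affine (b c : R) : measurable_fun [set: R] (affine b c).
Proof. by apply: measurable_funD => //; exact: mulrl_measurable. Qed.

Lemma lebesgue_measure_affine (b c : R) (A : set R) : b != 0 -> measurable A ->
  mu A = (`|b|%:E * mu (affine b c @^-1` A))%E.
Proof.
move=> b0 mA.
pose b' : {nonneg R} := NngNum (normr_ge0 b).
pose f := affine b c : measurableTypeR R -> measurableTypeR R.
rewrite (_ : (_ * _)%E = mscale b' (pushforward mu f) A)//.
  exact: measurable_affine.
move=> mf; apply: lebesgue_measure_unique => //=.
move=> _ [[u v] /= _ <-].
rewrite /= /mscale /= /pushforward.
have [b_gt0|b_le0] := ltP 0 b.
  rewrite (_ : _ @^-1` _ = `](u - c) / b, (v - c) / b]%classic); last first.
    apply/seteqP; split => x /=; rewrite /affine !in_itv/= ltr_pdivrMr// ler_pdivlMr// ltrBlDr lerBrDr.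
      by rewrite /f /affine mulrC.
    by rewrite /f /affine mulrC.
  rewrite !lebesgue_measure_itv/= !lte_fin ltr_pM2r ?invr_gt0// ltrD2r.
  case: ifPn => uv; last by rewrite mule0.
  by rewrite -!EFinD -EFinM gtr0_norm//; congr EFin; field.
have b_lt0 : b < 0 by rewrite lt_neqAle b0.
(* A negative slope exchanges the open and the closed end, which does not change the measure. *)
rewrite (_ : _ @^-1` _ = `[(v - c) / b, (u - c) / b[%classic); last first.
  apply/seteqP; split => x /=; rewrite /affine !in_itv/= ltr_ndivlMr// ler_ndivrMr// ltrBlDr lerBrDr.
    by rewrite /f /affine mulrC andbC.
  by rewrite /f /affine mulrC andbC.
rewrite !lebesgue_measure_itv/= !lte_fin ltr_nM2r ?invr_lt0// ltrD2r.
case: ifPn => uv; last by rewrite mule0.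
by rewrite -!EFinD -EFinM ltr0_norm//; congr EFin; field.
Qed.

Lemma ge0_integral_affine (b c : R) (f : R -> \bar R) : b != 0 ->
  measurable_fun [set: R] f -> (forall x, 0 <= f x)%E ->
  (\int[mu]_x f (b * x + c)%R = `|b|^-1%:E * \int[mu]_x f x)%E.
Proof.
move=> b0 mf f0.
pose b' : {nonneg R} := NngNum (normr_ge0 b).
pose g := affine b c : measurableTypeR R -> measurableTypeR R.
have mg : measurable_fun setT g by exact: measurable_affine.
transitivity (\int[pushforward mu g]_x f x)%E.
  by rewrite ge0_integral_pushforward.
have -> : (\int[mu]_x f x = `|b|%:E * \int[pushforward mu g]_x f x)%E.
  rewrite -(@ge0_integral_mscale _ _ _ (pushforward mu g) setT measurableT b' f)//.
  apply: eq_measure_integral => A mA _.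
  exact: (lebesgue_measure_affine c b0).
by rewrite muleA -EFinM mulVf ?mul1e// normr_eq0.
Qed.

Lemma integrable_affine (b c : R) (f : R -> R) : b != 0 ->
  mu.-integrable [set: R] (EFin \o f) ->
  mu.-integrable [set: R] (EFin \o (fun x => f (b * x + c))).
Proof.
move=> b0 /integrableP[mf foo].
have mf' : measurable_fun [set: R] f by apply/measurable_EFinP.
apply/integrableP; split.
  by apply/measurable_EFinP; exact: (measurableT_comp mf' (measurable_affine b c)).
rewrite /= (ge0_integral_affine c b0 (f := fun x => `|(f x)%:E|%E))//.
  by rewrite lte_mul_pinfty// lee_fin invr_ge0.
by apply: measurableT_comp => //; apply/measurable_EFinP.
Qed.

Lemma Rintegral_affine (b c : R) (f : R -> R) : b != 0 ->
  mu.-integrable [set: R] (EFin \o f) ->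
  \int[mu]_x f (b * x + c) = `|b|^-1 * \int[mu]_x f x.
Proof.
move=> b0 fi.
have mf : measurable_fun [set: R] (EFin \o f) by exact: measurable_int fi.
rewrite /Rintegral [X in fine X]integralE [X in _ * fine X]integralE.
have e (g : R -> \bar R) : measurable_fun setT g -> (forall x, 0 <= g x)%E ->
    (\int[mu]_x g (b * x + c)%R = (`|b|^-1)%:E * \int[mu]_x g x)%E.
  exact: ge0_integral_affine.
have -> : (\int[mu]_x (fun x => (f (b * x + c))%:E)^\+ x =
    (`|b|^-1)%:E * \int[mu]_x (EFin \o f)^\+ x)%E.
  by rewrite -(e (EFin \o f)^\+%E (measurable_funepos mf) (funepos_ge0 _));
    apply: eq_integral => x _; rewrite !funeposE.
have -> : (\int[mu]_x (fun x => (f (b * x + c))%:E)^\- x =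
    (`|b|^-1)%:E * \int[mu]_x (EFin \o f)^\- x)%E.
  by rewrite -(e (EFin \o f)^\-%E (measurable_funeneg mf) (funeneg_ge0 _));
    apply: eq_integral => x _; rewrite !funenegE.
have fp := integrable_pos_fin_num measurableT fi; have fn := integrable_neg_fin_num measurableT fi.
by rewrite -(fineK fp) -(fineK fn) /= mulrBr.
Qed.

End affine.

Section Rintegral_fubini.
Context {R : realType}.
Local Notation mu := (@lebesgue_measure R).

(** The inner integrals of Fubini's theorem are extended reals, finite only almost everywhere.
    Real-valued integrals apply [fine] to them, which changes them on a null set only. *)
Lemma integrable_fine d (T : measurableType d) (m : {measure set T -> \bar R})
    (F : T -> \bar R) : m.-integrable [set: T] F ->
  m.-integrable [set: T] (EFin \o (fine \o F)) /\
  (\int[m]_x (EFin \o (fine \o F)) x = \int[m]_x F x)%E.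
Proof.
move=> iF; have mF := measurable_int _ iF.
have mfF : measurable_fun [set: T] (EFin \o (fine \o F)).
  by apply/measurable_EFinP; apply: measurableT_comp => //; exact: fine_measurable.
split.
  apply: le_integrable iF => // x _ /=.
  by case: (F x) => [r| |]//=; rewrite normr0 leey.
apply: ae_eq_integral => //.
have := integrable_ae measurableT iF.
apply: filterS => x /= /(_ I) Fx _.
by rewrite fineK.
Qed.

Lemma integrable_prod_ge0 (f : R * R -> R) : measurable_fun [set: R * R] f ->
  (\int[mu]_x \int[mu]_y `|f (x, y)|%:E < +oo)%E ->
  (mu \x mu)%E.-integrable [set: R * R] (EFin \o f).
Proof.
move=> mf foo; apply/integrable12ltyP => //=; first exact/measurable_EFinP.
Qed.

Lemma Rintegral_fubini1 (f : R * R -> R) :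
  (mu \x mu)%E.-integrable [set: R * R] (EFin \o f) ->
  mu.-integrable [set: R] (EFin \o (fun x => \int[mu]_y f (x, y))) /\
  (\int[mu]_x (\int[mu]_y f (x, y))) = \int[(mu \x mu)%E]_z f z.
Proof.
move=> fi; have [i1 i2] := integrable_fine (integrable_fubini_F fi).
split; first exact: i1.
rewrite [RHS]/Rintegral -(integral12_prod_meas1 fi) -i2//.
Qed.

Lemma Rintegral_fubini2 (f : R * R -> R) :
  (mu \x mu)%E.-integrable [set: R * R] (EFin \o f) ->
  \int[mu]_y (\int[mu]_x f (x, y)) = \int[(mu \x mu)%E]_z f z.
Proof.
move=> fi; have := integrable_fubini_F fi.
(* This marginal is dominated by the marginal of the absolute value, whose integral is finite by
   Tonelli. *)
have iG : mu.-integrable [set: R] (fubini_G mu (EFin \o f)).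
  apply/integrableP; split; first exact: measurable_fubini_G fi.
  apply: (le_lt_trans _ ((integrable21ltyP _ _ _).1 fi)); last exact: measurable_int fi.
  have mf := measurable_int _ fi.
  apply: ge0_le_integral => //.
  - apply: measurableT_comp => //; exact: measurable_fubini_G fi.
  - have maf : measurable_fun [set: R * R] (abse \o (EFin \o f)) by exact: measurableT_comp.
    exact: (measurable_fun_fubini_tonelli_G (m1 := mu) _ maf (fun=> abse_ge0 _)).
  - move=> y _; apply: le_abse_integral => //.
    exact: measurableT_comp.
have [_ i2] := integrable_fine iG.
by rewrite [RHS]/Rintegral -(integral21_prod_meas1 fi) -i2.
Qed.

Lemma Rintegral_fubini (f : R * R -> R) :
  (mu \x mu)%E.-integrable [set: R * R] (EFin \o f) ->
  \int[mu]_x (\int[mu]_y f (x, y)) = \int[mu]_y (\int[mu]_x f (x, y)).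
Proof. by move=> fi; rewrite (Rintegral_fubini1 fi).2 Rintegral_fubini2. Qed.

(* Sections that are not integrable contribute the junk value of [Rintegral]. *)
Lemma measurable_Rintegral_snd (f : R * R -> R) : measurable_fun [set: R * R] f ->
  measurable_fun [set: R] (fun x => \int[mu]_y f (x, y)).
Proof.
move=> mf; rewrite /Rintegral; apply: measurableT_comp => //.
under eq_fun do rewrite integralE.
have mE : measurable_fun [set: R * R] (EFin \o f) by exact/measurable_EFinP.
apply: emeasurable_funB.
- have := measurable_fun_fubini_tonelli_F (m2 := mu) (EFin \o f)^\+%E (measurable_funepos mE) (funepos_ge0 _).
  by apply: eq_measurable_fun => x _; apply: eq_integral => y _; rewrite !funeposE.
- have := measurable_fun_fubini_tonelli_F (m2 := mu) (EFin \o f)^\-%E (measurable_funeneg mE) (funeneg_ge0 _).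
  by apply: eq_measurable_fun => x _; apply: eq_integral => y _; rewrite !funenegE.
Qed.

End Rintegral_fubini.

(** * Complex-valued integrals *)

Local Notation normc := Normc.normc.

Section complex_norm.
Context {R : rcfType}.
Implicit Types z w : R[i].

Lemma normc_ge0 z : 0 <= normc z.
Proof. by case: z => a b; exact: sqrtr_ge0. Qed.

Lemma normc_conj z : normc (z^*) = normc z.
Proof. by case: z => a b /=; rewrite sqrrN. Qed.

Lemma normc_real (a : R) : normc (a%:C) = `|a|.
Proof. by rewrite /= expr0n/= addr0 sqrtr_sqr. Qed.

Lemma normr_Re_le z : `|complex.Re z| <= normc z.
Proof. by case: z => a b /=; rewrite -sqrtr_sqr ler_wsqrtr// lerDl sqr_ge0. Qed.

Lemma normr_Im_le z : `|complex.Im z| <= normc z.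
Proof. by case: z => a b /=; rewrite -sqrtr_sqr ler_wsqrtr// lerDr sqr_ge0. Qed.

Lemma normc_le_ReIm z : normc z <= `|complex.Re z| + `|complex.Im z|.
Proof.
case: z => a b /=; rewrite -[leRHS]ger0_norm ?addr_ge0// -[leRHS]sqrtr_sqr.
by rewrite ler_wsqrtr// sqrrD !real_normK ?num_real// -addrA lerD2l lerDr mulrn_wge0// mulr_ge0.
Qed.

Lemma ReM z w :
  complex.Re (z * w) = complex.Re z * complex.Re w - complex.Im z * complex.Im w.
Proof. by case: z w => [a b] [c d]. Qed.

Lemma ImM z w :
  complex.Im (z * w) = complex.Re z * complex.Im w + complex.Im z * complex.Re w.
Proof. by case: z w => [a b] [c d] /=; rewrite addrC [b * c]mulrC addrC. Qed.

Lemma Re_conj z : complex.Re z^* = complex.Re z. Proof. by case: z. Qed.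

Lemma Im_conj z : complex.Im z^* = - complex.Im z. Proof. by case: z. Qed.

Lemma ReD z w : complex.Re (z + w) = complex.Re z + complex.Re w.
Proof. by case: z w => [a b] [c d]. Qed.

Lemma ImD z w : complex.Im (z + w) = complex.Im z + complex.Im w.
Proof. by case: z w => [a b] [c d]. Qed.

Lemma ReN z : complex.Re (- z) = - complex.Re z. Proof. by case: z. Qed.

Lemma ImN z : complex.Im (- z) = - complex.Im z. Proof. by case: z. Qed.

Lemma complex_eq z w : complex.Re z = complex.Re w ->
  complex.Im z = complex.Im w -> z = w.
Proof. by case: z w => [a b] [c d] /= -> ->. Qed.

End complex_norm.

Section expi_facts.
Context {R : realType}.

Lemma normc_expi (x : R) : normc (expi x) = 1.
Proof. by rewrite /= cos2Dsin2 sqrtr1. Qed.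

Lemma expiD (x y : R) : expi (x + y) = expi x * expi y.
Proof.
by apply: complex_eq; rewrite ?ReM ?ImM /= ?cosD ?sinD// addrC.
Qed.

Lemma expi_conj (x : R) : (expi x)^* = expi (- x).
Proof. by apply: complex_eq; rewrite ?Re_conj ?Im_conj /= ?cosN ?sinN. Qed.

Lemma expi0 : expi 0 = 1 :> R[i].
Proof. by apply: complex_eq; rewrite /= ?cos0 ?sin0. Qed.

End expi_facts.

Section cmeasurable_facts.
Context {R : realType} d (T : measurableType d).
Implicit Types F G : T -> R[i].

Lemma cmeasurable_normc F : cmeasurable F -> measurable_fun [set: T] (fun p => normc (F p)).
Proof.
move=> [mr mi].
rewrite (_ : (fun p => _) = Num.sqrt \o (fun p => complex.Re (F p) ^+ 2 + complex.Im (F p) ^+ 2)).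
  apply: measurableT_comp; first (apply: continuous_measurable_fun; exact: sqrt_continuous).
  by apply: measurable_funD; exact: measurable_funX.
by apply/funext => p /=; case: (F p).
Qed.

Lemma cmeasurableM F G : cmeasurable F -> cmeasurable G ->
  cmeasurable (fun p => F p * G p).
Proof.
move=> [rF iF] [rG iG]; split.
  under eq_fun do rewrite ReM.
  by apply: measurable_funB; exact: measurable_funM.
under eq_fun do rewrite ImM.
by apply: measurable_funD; exact: measurable_funM.
Qed.

Lemma cmeasurableB F G : cmeasurable F -> cmeasurable G ->
  cmeasurable (fun p => F p - G p).
Proof.
move=> [rF iF] [rG iG]; split.
  by under eq_fun do rewrite ReD ReN; exact: measurable_funB.
by under eq_fun do rewrite ImD ImN; exact: measurable_funB.
Qed.

Lemma cmeasurable_conj F : cmeasurable F -> cmeasurable (fun p => (F p)^*).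
Proof.
move=> [rF iF]; split; first by under eq_fun do rewrite Re_conj.
by under eq_fun do rewrite Im_conj; exact: measurable_funN.
Qed.

Lemma cmeasurable_real (f : T -> R) : measurable_fun [set: T] f ->
  cmeasurable (fun p => (f p)%:C).
Proof. by move=> mf; split => //=; exact: measurable_cst. Qed.

Lemma cmeasurable_cst (z : R[i]) : cmeasurable (fun _ : T => z).
Proof. by split; exact: measurable_cst. Qed.

Lemma cmeasurable_expi (f : T -> R) : measurable_fun [set: T] f ->
  cmeasurable (fun p => expi (f p)).
Proof.
move=> mf; split => /=.
  by apply: measurableT_comp mf; apply: continuous_measurable_fun; exact: continuous_cos.
by apply: measurableT_comp mf; apply: continuous_measurable_fun; exact: continuous_sin.
Qed.

Lemma cmeasurable_comp d' (T' : measurableType d') (g : T' -> T) F :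
  measurable_fun [set: T'] g -> cmeasurable F -> cmeasurable (fun p => F (g p)).
Proof.
by move=> mg [rF iF]; split;
  [exact: (measurableT_comp rF mg) | exact: (measurableT_comp iF mg)].
Qed.

End cmeasurable_facts.

Section cintegral_facts.
Context {R : realType}.
Local Notation mu := (@lebesgue_measure R).
Implicit Types f g : R -> R[i].

Lemma cintegrable_measurable f : cintegrable f -> cmeasurable f.
Proof.
by move=> [fr fi]; split; apply/measurable_EFinP; [exact: measurable_int fr|exact: measurable_int fi].
Qed.

Lemma integrable_normc f : cintegrable f ->
  mu.-integrable [set: R] (fun t => (normc (f t))%:E).
Proof.
move=> fi; have [rf imf] := fi.
have mf := cmeasurable_normc (cintegrable_measurable fi).
have : mu.-integrable [set: R]
    (fun t => `|(complex.Re (f t))%:E| + `|(complex.Im (f t))%:E|)%E.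
  by apply: integrableD => //; exact: integrable_abse.
apply: le_integrable => //; first exact/measurable_EFinP.
move=> t _ /=; rewrite lee_fin [leRHS]ger0_norm ?addr_ge0// ger0_norm ?normc_ge0//.
exact: normc_le_ReIm.
Qed.

Lemma le_cintegrable f (g : R -> R) : cmeasurable f ->
  mu.-integrable [set: R] (EFin \o g) -> (forall t, normc (f t) <= g t) ->
  cintegrable f.
Proof.
move=> [mr mi] ig fg; split; (apply: le_integrable ig => //; first exact/measurable_EFinP) => t _ /=;
  rewrite lee_fin (le_trans _ (ler_norm (g t)))// (le_trans _ (fg t))//.
- exact: normr_Re_le.
- exact: normr_Im_le.
Qed.

Lemma cintegrable_lty f : cmeasurable f ->
  (\int[mu]_t (normc (f t))%:E < +oo)%E -> cintegrable f.
Proof.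
move=> mf foo; apply: (le_cintegrable (g := fun t => normc (f t))) => //.
apply/integrableP; split; first by apply/measurable_EFinP; exact: cmeasurable_normc.
by under eq_integral do rewrite /= ger0_norm ?normc_ge0//.
Qed.

Lemma eq_cintegral f g : f =1 g -> cintegral f = cintegral g.
Proof. by move=> /funext ->. Qed.

Lemma cintegralD f g : cintegrable f -> cintegrable g ->
  cintegral (fun t => f t + g t) = cintegral f + cintegral g.
Proof.
move=> [rf imf] [rg img]; apply: complex_eq; rewrite ?ReD ?ImD /=.
  by rewrite -RintegralD//; apply: eq_Rintegral => t _; rewrite ReD.
by rewrite -RintegralD//; apply: eq_Rintegral => t _; rewrite ImD.
Qed.

Lemma cintegrableD f g : cintegrable f -> cintegrable g ->
  cintegrable (fun t => f t + g t).
Proof.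
move=> [rf imf] [rg img]; split.
  by apply: eq_integrable (integrableD measurableT rf rg) => // t _; rewrite ReD.
by apply: eq_integrable (integrableD measurableT imf img) => // t _; rewrite ImD.
Qed.

Lemma cintegrableZl (c : R[i]) f : cintegrable f -> cintegrable (fun t => c * f t).
Proof.
move=> fi; apply: (le_cintegrable (g := fun t => normc c * normc (f t))).
- by apply: cmeasurableM; [exact: cmeasurable_cst|exact: cintegrable_measurable].
- by have := integrableZl measurableT (normc c) (integrable_normc fi).
- by move=> t; rewrite Normc.normcM.
Qed.

Lemma cintegralZl (c : R[i]) f : cintegrable f ->
  cintegral (fun t => c * f t) = c * cintegral f.
Proof.
move=> [rf imf]; apply: complex_eq; rewrite ?ReM ?ImM /=.
  rewrite -!RintegralZl// -RintegralB//.
  - by apply: eq_Rintegral => t _; rewrite ReM.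
  - exact: (integrableZl measurableT (complex.Re c) rf).
  - exact: (integrableZl measurableT (complex.Im c) imf).
rewrite -!RintegralZl// -RintegralD//.
- by apply: eq_Rintegral => t _; rewrite ImM.
- exact: (integrableZl measurableT (complex.Re c) imf).
- exact: (integrableZl measurableT (complex.Im c) rf).
Qed.

Lemma cintegralZr (c : R[i]) f : cintegrable f ->
  cintegral (fun t => f t * c) = cintegral f * c.
Proof.
by move=> fi; rewrite mulrC -cintegralZl//; apply: eq_cintegral => t; rewrite mulrC.
Qed.

Lemma cintegralB f g : cintegrable f -> cintegrable g ->
  cintegral (fun t => f t - g t) = cintegral f - cintegral g.
Proof.
move=> fi gi; rewrite -[- cintegral g]mulN1r -cintegralZl// -cintegralD//.
  by apply: eq_cintegral => t; rewrite mulN1r.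
exact: cintegrableZl.
Qed.

Lemma cintegrable_conj f : cintegrable f -> cintegrable (fun t => (f t)^*).
Proof.
move=> fi; apply: (le_cintegrable (g := fun t => normc (f t))).
- exact/cmeasurable_conj/cintegrable_measurable.
- exact: integrable_normc.
- by move=> t; rewrite normc_conj.
Qed.

Lemma cintegral_conj f : cintegrable f ->
  cintegral (fun t => (f t)^*) = (cintegral f)^*.
Proof.
move=> [rf imf]; apply: complex_eq; rewrite ?Re_conj ?Im_conj /=.
  by apply: eq_Rintegral => t _; rewrite Re_conj.
rewrite -mulN1r -RintegralZl//; apply: eq_Rintegral => t _.
by rewrite Im_conj mulN1r.
Qed.

(* The factor 2 is not sharp, but it spares a polar decomposition. *)
Lemma normc_cintegral_le f : cintegrable f ->
  ((normc (cintegral f))%:E <= 2%:E * \int[mu]_t (normc (f t))%:E)%E.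
Proof.
move=> fi; have [rf imf] := fi; have nf := integrable_normc fi.
have nf_fin : (\int[mu]_t (normc (f t))%:E)%E \is a fin_num.
  exact: integrable_fin_num.
rewrite -(fineK nf_fin) -EFinM lee_fin (le_trans (normc_le_ReIm _))//= mulr2n mulrDl mul1r.
apply: lerD; (apply: (le_trans (le_normr_Rintegral measurableT _)) => //;
  apply: le_Rintegral => //; first exact: integrable_norm) => t _.
- exact: normr_Re_le.
- exact: normr_Im_le.
Qed.

Lemma cintegrable_affine (b c : R) f : b != 0 -> cintegrable f ->
  cintegrable (fun t => f (b * t + c)).
Proof.
by move=> b0 [rf imf]; split; [exact: (integrable_affine c b0 rf)|exact: (integrable_affine c b0 imf)].
Qed.

Lemma cintegral_affine (b c : R) f : b != 0 -> cintegrable f ->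
  cintegral (fun t => f (b * t + c)) = (`|b|^-1)%:C * cintegral f.
Proof.
move=> b0 [rf imf]; apply: complex_eq; rewrite ?ReM ?ImM /= mul0r ?subr0 ?addr0.
  exact: (Rintegral_affine c b0 rf).
exact: (Rintegral_affine c b0 imf).
Qed.

Lemma cintegral_fubini (F : R * R -> R[i]) : cmeasurable F ->
  (\int[mu]_x \int[mu]_y (normc (F (x, y)))%:E < +oo)%E ->
  cintegrable (fun x => cintegral (fun y => F (x, y))) /\
  cintegral (fun x => cintegral (fun y => F (x, y))) =
  cintegral (fun y => cintegral (fun x => F (x, y))).
Proof.
move=> mF Foo; have [mr mi] := mF.
have mn : measurable_fun [set: R * R] (fun p => (normc (F p))%:E).
  by apply/measurable_EFinP; exact: cmeasurable_normc.
have iF : (mu \x mu)%E.-integrable [set: R * R] (fun p => (normc (F p))%:E).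
  apply/integrable12ltyP => //.
  by under eq_integral do under eq_integral do rewrite abse_EFin ger0_norm ?normc_ge0//.
have ir : (mu \x mu)%E.-integrable [set: R * R] (EFin \o (fun p => complex.Re (F p))).
  apply: le_integrable iF => //; first exact/measurable_EFinP.
  by move=> p _ /=; rewrite lee_fin [leRHS]ger0_norm ?normc_ge0 ?normr_Re_le.
have ii : (mu \x mu)%E.-integrable [set: R * R] (EFin \o (fun p => complex.Im (F p))).
  apply: le_integrable iF => //; first exact/measurable_EFinP.
  by move=> p _ /=; rewrite lee_fin [leRHS]ger0_norm ?normc_ge0 ?normr_Im_le.
split; first by split; [exact: (Rintegral_fubini1 ir).1|exact: (Rintegral_fubini1 ii).1].
by apply: complex_eq => /=; [exact: (Rintegral_fubini ir)|exact: (Rintegral_fubini ii)].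
Qed.

Lemma cmeasurable_cintegral_snd (F : R * R -> R[i]) : cmeasurable F ->
  cmeasurable (fun x => cintegral (fun y => F (x, y))).
Proof.
by move=> [mr mi]; split; [exact: (measurable_Rintegral_snd mr)|exact: (measurable_Rintegral_snd mi)].
Qed.

End cintegral_facts.

(** * Square-integrable functions *)

Section square_integrable.
Context {R : realType}.
Local Notation mu := (@lebesgue_measure R).
Implicit Types f g h k : R -> R[i].

(** As a plain integral of a nonnegative function, the squared norm is directly accessible to
    Tonelli and to affine changes of variables. *)
Definition sqnorm f : \bar R := (\int[mu]_t ((normc (f t)) ^+ 2)%:E)%E.

Lemma sqnorm_ge0 f : (0 <= sqnorm f)%E.
Proof. by apply: integral_ge0 => t _; rewrite lee_fin sqr_ge0. Qed.

Lemma sqnormE f : sqnorm f = (cnorm 2 f `^ 2)%E.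
Proof.
rewrite /cnorm poweR_Lnorm ?pnatr_eq0//; apply: eq_integral => t _ /=.
by rewrite ger0_norm ?normc_ge0// powR_mulrn ?normc_ge0.
Qed.

Lemma cnorm2_lty f : (cnorm 2 f < +oo)%E <-> (sqnorm f < +oo)%E.
Proof.
rewrite sqnormE; split; first exact: poweR_lty.
by move=> /lty_poweRy; apply; rewrite pnatr_eq0.
Qed.

Lemma cnorm2_lt f (e : R) : 0 < e -> (cnorm 2 f < e%:E)%E ->
  (sqnorm f <= (e ^+ 2)%:E)%E.
Proof.
move=> e0 fe; rewrite sqnormE.
have -> : (e ^+ 2)%:E = (e%:E `^ 2)%E by rewrite poweR_EFin powR_mulrn// ltW.
apply: gt0_ler_poweR => //; last exact: ltW.
- by rewrite in_itv/= Lnorm_ge0 leey.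
- by rewrite in_itv/= lee_fin ltW// leey.
Qed.

Lemma cnorm1E f : cnorm 1 f = (\int[mu]_t (normc (f t))%:E)%E.
Proof.
rewrite /cnorm Lnorm1; apply: eq_integral => t _ /=.
by rewrite ger0_norm ?normc_ge0.
Qed.

Lemma cLp1_cintegrable f : cLp 1 f -> cintegrable f.
Proof. by move=> [mf]; rewrite cnorm1E; exact: cintegrable_lty. Qed.

Lemma sqnorm_affine (b c : R) f : b != 0 -> cmeasurable f ->
  sqnorm (fun t => f (b * t + c)) = ((`|b|^-1)%:E * sqnorm f)%E.
Proof.
move=> b0 mf; rewrite /sqnorm.
rewrite (ge0_integral_affine c b0 (f := fun t => ((normc (f t)) ^+ 2)%:E))//.
- by apply/measurable_EFinP; apply: measurable_funX; exact: cmeasurable_normc.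
- by move=> t; rewrite lee_fin sqr_ge0.
Qed.

Lemma sqnorm_conj f : sqnorm (fun t => (f t)^*) = sqnorm f.
Proof. by apply: eq_integral => t _; rewrite normc_conj. Qed.

Lemma integrable_sqnorm f : cmeasurable f -> (sqnorm f < +oo)%E ->
  mu.-integrable [set: R] (EFin \o (fun t => (normc (f t)) ^+ 2)).
Proof.
move=> mf foo; apply/integrableP; split.
  by apply/measurable_EFinP; apply: measurable_funX; exact: cmeasurable_normc.
by under eq_integral do rewrite /= ger0_norm ?sqr_ge0//.
Qed.

Lemma mulr_le_weighted (e x y : R) : 0 < e -> 2 * (x * y) <= e * x ^+ 2 + e^-1 * y ^+ 2.
Proof.
move=> e0; rewrite -subr_ge0.
have -> : e * x ^+ 2 + e^-1 * y ^+ 2 - 2 * (x * y) = e * (x - e^-1 * y) ^+ 2.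
  by field; rewrite gt_eqF.
by rewrite mulr_ge0 ?sqr_ge0 ?ltW.
Qed.

Lemma cintegrableM k f : cmeasurable k -> cmeasurable f ->
  (sqnorm k < +oo)%E -> (sqnorm f < +oo)%E -> cintegrable (fun t => k t * f t).
Proof.
move=> mk mf koo foo.
apply: (le_cintegrable (g := fun t => (normc (k t)) ^+ 2 + (normc (f t)) ^+ 2)).
- exact: cmeasurableM.
- exact: (integrableD measurableT (integrable_sqnorm mk koo) (integrable_sqnorm mf foo)).
- move=> t; rewrite Normc.normcM.
  have := mulr_le_weighted (normc (k t)) (normc (f t)) ltr01.
  rewrite invr1 !mul1r; apply: le_trans.
  by rewrite mulr2n mulrDl mul1r lerDl mulr_ge0 ?normc_ge0.
Qed.

(** Weighted AM-GM in place of Cauchy-Schwarz: if [sqnorm f] is of order [e ^+ 2], the bound is of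
    order [e], which is what a limit argument needs. The factor 2 of [normc_cintegral_le] is the one
    in 2xy. *)
Lemma normc_cintegralM_le k f (e : R) : 0 < e -> cmeasurable k -> cmeasurable f ->
  (sqnorm k < +oo)%E -> (sqnorm f < +oo)%E ->
  ((normc (cintegral (fun t => (k t * f t)%R)))%:E <= e%:E * sqnorm k + e^-1%:E * sqnorm f)%E.
Proof.
move=> e0 mk mf koo foo.
have kfi := cintegrableM mk mf koo foo.
apply: (le_trans (normc_cintegral_le kfi)).
have ik := integrable_sqnorm mk koo; have jf := integrable_sqnorm mf foo.
rewrite -!integralZl//=; last exact: integrable_normc.
rewrite -integralD//; [|exact: integrableZl|exact: integrableZl].
apply: ge0_le_integral => //.
- by move=> t _; rewrite mule_ge0// lee_fin normc_ge0.
- by apply: emeasurable_funM => //; exact: measurable_int (integrable_normc kfi).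
- apply: emeasurable_funD; apply: emeasurable_funM => //; [exact: measurable_int ik|exact: measurable_int jf].
- move=> t _; rewrite -!EFinM -EFinD lee_fin Normc.normcM.
  exact: mulr_le_weighted.
Qed.

Lemma eq0_le_eps (x C : R) : 0 <= x -> (forall e, 0 < e -> x <= e * C) -> x = 0.
Proof.
move=> x0 xe; apply/eqP; rewrite eq_le x0 andbT leNgt; apply/negP => x_gt0.
have C0 : 0 <= C by have := xe 1 ltr01; rewrite mul1r; exact: le_trans.
have C1 : 0 < C + 1 by rewrite ltr_wpDl.
have := xe (x / (C + 1)) (divr_gt0 x_gt0 C1).
rewrite mulrAC ler_pdivlMr// ler_pM2l// leNgt ltrDl ltr01//.
Qed.

Lemma normc_eq0_le_eps (z : R[i]) (C : R) : (forall e, 0 < e -> normc z <= e * C) -> z = 0.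
Proof. by move=> h; apply: Normc.eq0_normc; apply: eq0_le_eps h; exact: normc_ge0. Qed.

Lemma is_fourier2_approx f g : is_fourier2 f g ->
  [/\ cmeasurable f, cmeasurable g, (sqnorm f < +oo)%E, (sqnorm g < +oo)%E &
  forall e : R, 0 < e -> exists h, [/\ cintegrable h, (sqnorm h < +oo)%E,
    (sqnorm (fun t => (f t - h t)%R) <= (e ^+ 2)%:E)%E &
    (sqnorm (fun t => (g t - fourier1 h t)%R) <= (e ^+ 2)%:E)%E]].
Proof.
move=> [[mf foo] [mg goo] fg]; split => //; [exact/cnorm2_lty|exact/cnorm2_lty|].
move=> e e0; have [h [h1 [mh h2] fh gh]] := fg e e0; exists h; split.
- exact: cLp1_cintegrable.
- exact/cnorm2_lty.
- exact: cnorm2_lt.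
- exact: cnorm2_lt.
Qed.

Lemma cmeasurable_fourier1 h : cmeasurable h -> cmeasurable (fourier1 h).
Proof.
move=> mh; rewrite /fourier1.
have := @cmeasurable_cintegral_snd _ (fun p : R * R => h p.2 * expi (- (2 * pi * p.2 * p.1))).
apply; apply: cmeasurableM; first by apply: cmeasurable_comp mh; exact: measurable_snd.
apply: cmeasurable_expi; apply: measurable_funN; apply: measurable_funM => //.
by apply: measurable_funM.
Qed.

End square_integrable.

(** * Young's inequality for integral kernels *)

Section young.
Context {R : realType}.
Local Notation mu := (@lebesgue_measure R).

Lemma sqr_le_of_weighted (n a B : R) : 0 <= n -> 0 < a -> 0 <= B ->
  (forall s, 0 < s -> n <= s^-1 * a + s * B) -> n ^+ 2 <= 4 * a * B.
Proof.
move=> n0 a0 B0 h; have [->|nneq0] := eqVneq n 0.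
  by rewrite expr0n/= !mulr_ge0// ltW.
have n_gt0 : 0 < n by rewrite lt_neqAle eq_sym nneq0.
(* This weight makes the first term equal to [n / 2], to be absorbed by the left-hand side; the
   second is [2 * a * B / n]. *)
have := h (2 * a / n) (divr_gt0 (mulr_gt0 (ltr0n _ 2) a0) n_gt0).
rewrite -(ler_pM2r n_gt0).
have -> : ((2 * a / n)^-1 * a + 2 * a / n * B) * n = n ^+ 2 / 2 + 2 * a * B.
  by field; rewrite nneq0 gt_eqF.
rewrite -expr2; move: (n ^+ 2) => m; lra.
Qed.

(* Young's inequality, through Cauchy-Schwarz in the form [n ^+ 2 <= 4 * a * B]
   obtained by optimizing the weight in AM-GM. *)
Lemma sqnorm_kernel_le (b I : R) (p : R -> R) (K : R * R -> R[i]) (f : R -> R[i]) :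
  0 < b -> 0 < I -> measurable_fun [set: R] p -> (forall t, 0 <= p t) ->
  (\int[mu]_t (p t)%:E <= I%:E)%E ->
  cmeasurable K -> (forall x u, normc (K (x, u)) <= p (x + b * u)) ->
  cmeasurable f -> (forall x, cintegrable (fun u => K (x, u) * f u)) ->
  (sqnorm (fun x => cintegral (fun u => (K (x, u) * f u)%R)) <=
   (4 * I ^+ 2 / b)%:E * sqnorm f)%E.
Proof.
move=> b0 I0 mp p0 pI mK Kp mf Kf.
have bn0 : b != 0 by rewrite gt_eqF.
have mpp : measurable_fun [set: R * R] (fun z => p (z.1 + b * z.2)).
  by apply: (measurableT_comp mp); apply: measurable_funD => //; exact: measurable_funM.
have mnf := cmeasurable_normc mf.
pose A x := (\int[mu]_u (p (x + b * u)%R * (normc (f u)) ^+ 2)%:E)%E.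
have mA2 : measurable_fun [set: R * R] (fun z => (p (z.1 + b * z.2) * (normc (f z.2)) ^+ 2)%:E).
  apply/measurable_EFinP; apply: measurable_funM => //; apply: measurable_funX.
  exact: (measurableT_comp mnf (@measurable_snd _ _ _ _)).
have A0 x : (0 <= A x)%E.
  by apply: integral_ge0 => u _; rewrite lee_fin mulr_ge0// sqr_ge0.
have mA : measurable_fun [set: R] A.
  apply: (measurable_fun_fubini_tonelli_F (m2 := mu) _ mA2) => z.
  by rewrite lee_fin mulr_ge0// sqr_ge0.
have pb x : (\int[mu]_u (p (x + b * u)%R)%:E <= (I / b)%:E)%E.
  under eq_integral do rewrite addrC.
  rewrite (ge0_integral_affine x bn0 (f := EFin \o p)) => [||t]; last 2 first.
  - exact/measurable_EFinP.
  - by rewrite lee_fin.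
  by rewrite gtr0_norm// mulrC EFinM lee_wpmul2l// lee_fin invr_ge0 ltW.
have pt x : (((normc (cintegral (fun u => (K (x, u) * f u)%R))) ^+ 2)%:E <=
    (4 * (I / b))%:E * A x)%E.
  have Ib0 : 0 < I / b by rewrite divr_gt0.
  (* [A x] may be infinite at some points, where the bound is trivial. *)
  have [Aoo|Afin] := eqVneq (A x) +oo%E.
    by rewrite Aoo gt0_muley ?leey// lte_fin mulr_gt0.
  have Afn : A x \is a fin_num by rewrite ge0_fin_numE// ltey.
  rewrite -(fineK Afn) -EFinM lee_fin.
  apply: sqr_le_of_weighted => //; [exact: normc_ge0|exact: fine_ge0|move=> s s0].
  rewrite -lee_fin EFinD !EFinM fineK//.
  apply: (le_trans (normc_cintegral_le (Kf x))).
  have mpx : measurable_fun [set: R] (fun u => p (x + b * u)).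
    by apply: (measurableT_comp mp); apply: measurable_funD => //; exact: measurable_funM.
  have mAx : measurable_fun [set: R] (fun u => p (x + b * u) * (normc (f u)) ^+ 2).
    by apply: measurable_funM => //; exact: measurable_funX.
  have mKf := cmeasurable_normc (cintegrable_measurable (Kf x)).
  rewrite -ge0_integralZl//=; first last.
  - by move=> t _; rewrite lee_fin normc_ge0.
  - exact/measurable_EFinP.
  apply: (@le_trans _ _ (s^-1%:E * \int[mu]_u (p (x + b * u)%R)%:E + s%:E * A x)%E); last first.
    by rewrite leeD2r// lee_wpmul2l// lee_fin invr_ge0 ltW.
  have sp0 : (0 <= s^-1%:E)%E by rewrite lee_fin invr_ge0 ltW.
  rewrite /A -!ge0_integralZl//=; first last.
  - by move=> u _; rewrite lee_fin.
  - exact/measurable_EFinP.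
  - by rewrite lee_fin ltW.
  - by move=> u _; rewrite lee_fin mulr_ge0// sqr_ge0.
  - exact/measurable_EFinP.
  rewrite -ge0_integralD//; first last.
  - by apply: emeasurable_funM => //; exact/measurable_EFinP.
  - move=> u _; rewrite -EFinM lee_fin; apply: mulr_ge0; first exact: ltW.
    by rewrite mulr_ge0// sqr_ge0.
  - by apply: emeasurable_funM => //; exact/measurable_EFinP.
  - by move=> u _; rewrite -EFinM lee_fin mulr_ge0// invr_ge0 ltW.
  apply: ge0_le_integral => //.
  - by move=> u _; rewrite -EFinM lee_fin mulr_ge0// normc_ge0.
  - by apply: emeasurable_funM => //; exact/measurable_EFinP.
  - by apply: emeasurable_funD; apply: emeasurable_funM => //; exact/measurable_EFinP.
  - move=> u _; rewrite -!EFinM -EFinD lee_fin Normc.normcM.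
    apply: (@le_trans _ _ (2 * (p (x + b * u) * normc (f u)))).
      by rewrite ler_pM2l// ler_wpM2r// normc_ge0.
    (* AM-GM is applied to 1 and the modulus of [f u], and only then multiplied by the density, so
       that [p] enters both terms to the first power. *)
    have := mulr_le_weighted 1 (normc (f u)) (e := s^-1).
    rewrite invr_gt0 => /(_ s0); rewrite invrK expr1n mulr1 mul1r => h.
    have := ler_wpM2l (p0 (x + b * u)) h.
    lra.
apply: (@le_trans _ _ (\int[mu]_x ((4 * (I / b))%:E * A x))%E).
  apply: ge0_le_integral => //.
  - by move=> x _; rewrite lee_fin sqr_ge0.
  - apply/measurable_EFinP; apply: measurable_funX; apply: cmeasurable_normc.
    apply: (cmeasurable_cintegral_snd (F := fun z => K z * f z.2)).
    by apply: cmeasurableM => //; apply: cmeasurable_comp mf; exact: measurable_snd.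
  - exact: emeasurable_funM.
rewrite ge0_integralZl//; last by rewrite lee_fin mulr_ge0// divr_ge0// ltW.
have -> : (4 * I ^+ 2 / b)%:E = ((4 * (I / b))%:E * I%:E)%E.
  by rewrite -EFinM; congr EFin; ring.
rewrite -muleA; apply: lee_wpmul2l; first by rewrite lee_fin mulr_ge0// divr_ge0// ltW.
rewrite /A (fubini_tonelli (m1 := mu) (m2 := mu) _ mA2) => [|z]; last first.
  by rewrite lee_fin mulr_ge0// sqr_ge0.
rewrite /= /sqnorm.
have mf2 : measurable_fun [set: R] (fun u => ((normc (f u)) ^+ 2)%:E).
  by apply/measurable_EFinP; exact: measurable_funX.
rewrite -ge0_integralZl//=; [|by move=> u _; rewrite lee_fin sqr_ge0|by rewrite lee_fin ltW].
apply: ge0_le_integral => //.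
- by move=> u _; apply: integral_ge0 => x _; rewrite lee_fin mulr_ge0// sqr_ge0.
- apply: (measurable_fun_fubini_tonelli_G (m1 := mu) _ mA2) => z.
  by rewrite lee_fin mulr_ge0// sqr_ge0.
- exact: emeasurable_funM.
- move=> u _.
  under eq_integral do rewrite EFinM muleC.
  have mpu : measurable_fun [set: R] (fun x => (p (x + b * u)%R)%:E).
    by apply/measurable_EFinP; apply: (measurableT_comp mp); exact: measurable_funD.
  rewrite ge0_integralZl//=; [|by move=> x _; rewrite lee_fin|by rewrite lee_fin sqr_ge0].
  rewrite muleC; apply: lee_wpmul2r; first by rewrite lee_fin sqr_ge0.
  under eq_integral do rewrite -[X in (X + _)%R]mul1r.
  rewrite (ge0_integral_affine (b * u) (oner_neq0 R) (f := EFin \o p)) => [||t]; last 2 first.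
  - exact/measurable_EFinP.
  - by rewrite lee_fin.
  by rewrite normr1 invr1 mul1e.
Qed.

End young.

(** * Approximation estimates and test windows *)

Section kernel_transform.
Context {R : realType}.
Local Notation mu := (@lebesgue_measure R).
Implicit Types (f g h k psi phi : R -> R[i]) (p q P Q : R -> R).

(** Carries an identity from an approximation [g] over to [f]. The factor [D] leaves room for a
    bounded operator applied to the approximation, such as a dilation or the map to the
    coefficients. *)
Lemma cintegralM_close k f g (D e : R) : 0 < e -> cmeasurable k -> cmeasurable f ->
  cmeasurable g -> (sqnorm k < +oo)%E -> (sqnorm f < +oo)%E ->
  (sqnorm (fun t => (f t - g t)%R) <= (D * e ^+ 2)%:E)%E ->
  cintegrable (fun t => k t * g t) /\
  normc (cintegral (fun t => k t * f t) - cintegral (fun t => k t * g t)) <=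
    e * (fine (sqnorm k) + D).
Proof.
move=> e0 mk mf mg koo foo fg.
have fgoo : (sqnorm (fun t => (f t - g t)%R) < +oo)%E by rewrite (le_lt_trans fg)// ltry.
have mfg : cmeasurable (fun t => f t - g t) by exact: cmeasurableB.
have ikf := cintegrableM mk mf koo foo.
have ikfg := cintegrableM mk mfg koo fgoo.
have ikg : cintegrable (fun t => k t * g t).
  have := cintegrableD ikf (cintegrableZl (-1) ikfg).
  by congr (cintegrable _); apply/funext => t; ring.
split=> //; rewrite -cintegralB//.
have -> : cintegral (fun t => k t * f t - k t * g t) =
    cintegral (fun t => k t * (f t - g t)) by apply: eq_cintegral => t; ring.
rewrite -lee_fin (le_trans (normc_cintegralM_le e0 mk mfg koo fgoo))//.
have kfin : sqnorm k \is a fin_num by rewrite ge0_fin_numE ?sqnorm_ge0.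
rewrite mulrDr EFinD EFinM fineK// leeD2l//.
apply: (@le_trans _ _ (e^-1%:E * (D * e ^+ 2)%:E)%E).
  by rewrite lee_wpmul2l// lee_fin invr_ge0 ltW.
by rewrite -EFinM lee_fin le_eqVlt; apply/orP; left; apply/eqP; field; rewrite gt_eqF.
Qed.

(** Boundedness and integrability together give square-integrability, so a window is a legitimate
    test function in both L^1 and L^2. *)
Definition window p := [/\ measurable_fun [set: R] p, forall t, 0 <= p t,
  exists B, forall t, p t <= B & mu.-integrable [set: R] (EFin \o p)].

Lemma window_sqnorm p (b c : R) f : window p -> b != 0 -> cmeasurable f ->
  (forall t, normc (f t) = p (b * t + c)) -> (sqnorm f < +oo)%E.
Proof.
move=> [mp p0 [B pB] ip] b0 mf fp.
have ib := integrable_affine c b0 ip.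
apply: (@le_lt_trans _ _ (\int[mu]_t (B%:E * (p (b * t + c)%R)%:E))%E).
  apply: ge0_le_integral => //.
  - by move=> t _; rewrite lee_fin sqr_ge0.
  - by apply/measurable_EFinP; apply: measurable_funX; exact: cmeasurable_normc.
  - by apply: emeasurable_funM => //; exact: measurable_int ib.
  - by move=> t _; rewrite -EFinM lee_fin fp expr2 ler_wpM2r.
by apply: integrable_lty => //; exact: integrableZl.
Qed.

Lemma tensor_lty (a1 a2 : R -> R) (F : R * R -> \bar R) :
  measurable_fun [set: R * R] F ->
  (forall z, 0 <= F z)%E -> (forall x y, F (x, y) <= (a1 x * a2 y)%:E)%E ->
  mu.-integrable [set: R] (EFin \o a1) -> mu.-integrable [set: R] (EFin \o a2) ->
  (\int[mu]_x \int[mu]_y F (x, y) < +oo)%E.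
Proof.
move=> mF F0 Fa i1 i2.
apply: (@le_lt_trans _ _ (\int[mu]_x \int[mu]_y (`|a1 x|%:E * `|a2 y|%:E))%E).
  have m1 := measurable_int _ i1; have m2 := measurable_int _ i2.
  have mm : measurable_fun [set: R * R] (fun z => `|a1 z.1|%:E * `|a2 z.2|%:E)%E.
    apply: emeasurable_funM; apply/measurable_EFinP; apply: measurableT_comp => //.
    + by apply: measurableT_comp => //; exact/measurable_EFinP.
    + by apply: measurableT_comp => //; exact/measurable_EFinP.
  apply: ge0_le_integral => //.
  - by move=> x _; apply: integral_ge0 => y _; exact: F0.
  - exact: (measurable_fun_fubini_tonelli_F (m2 := mu) _ mF F0).
  - apply: (measurable_fun_fubini_tonelli_F (m2 := mu) _ mm) => z.
    by rewrite mule_ge0// lee_fin.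
  - move=> x _; apply: ge0_le_integral => //.
    + by apply: (measurableT_comp mF); exact: pair1_measurable.
    + apply: emeasurable_funM => //; apply/measurable_EFinP; apply: measurableT_comp => //.
      exact/measurable_EFinP.
    + move=> y _; apply: (le_trans (Fa x y)).
      by rewrite -EFinM lee_fin -normrM ler_norm.
have n1 := integrable_norm i1; have n2 := integrable_norm i2.
under eq_integral do rewrite integralZl//.
have nf : (\int[mu]_y `|a2 y|%:E)%E \is a fin_num by apply: integrable_fin_num.
rewrite -(fineK nf).
under eq_integral do rewrite muleC.
rewrite integralZl// lte_mul_pinfty// ?lee_fin ?fine_ge0//.
  exact: integral_ge0.
exact: integrable_lty.
Qed.

End kernel_transform.

(** * The coefficients of an atom on the Fourier side *)

Section windowed_correlation.
(* In [ring_scope] the notation stands for [Num.conj]. *)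
Local Notation "z ^*" := (conjc z) : ring_scope.
Context {R : realType}.
Local Notation mu := (@lebesgue_measure R).
Implicit Types (f g h k psi phi : R -> R[i]) (p q P Q : R -> R).

Lemma conjcM (z w : R[i]) : (z * w)^* = z^* * w^*.
Proof. exact: rmorphM. Qed.

Lemma conjcB (z w : R[i]) : (z - w)^* = z^* - w^*.
Proof. exact: rmorphB. Qed.

Definition kern p (b c : R) (z : R * R) : R[i] :=
  (p (z.1 + b * z.2))%:C * expi (2 * pi * c * (z.1 + b * z.2)).

(* The inner product of [fun t => expi (2 * pi * c * t) * p t] with the translate
   by [x] of the dilate of [psi] by [b], up to the factor [b `^ 2^-1]. *)
Definition corr p (b c : R) psi (x : R) : R[i] :=
  cintegral (fun u => kern p b c (x, u) * (psi u)^*).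

(** An inverse Fourier transform that holds at every point. For the even functions to which it is
    applied, the sign of the exponent is immaterial. *)
Definition transform_of P p :=
  forall t, (p t)%:C = cintegral (fun y => (P y)%:C * expi (2 * pi * y * t)).

Lemma cmeasurable_kern p b c : measurable_fun [set: R] p -> cmeasurable (kern p b c).
Proof.
move=> mp.
have mz : measurable_fun [set: R * R] (fun z => z.1 + b * z.2).
  by apply: measurable_funD => //; exact: measurable_funM.
apply: cmeasurableM; first by apply: cmeasurable_real; exact: (measurableT_comp mp).
by apply: cmeasurable_expi; exact: measurable_funM.
Qed.

Lemma normc_kern p b c z : (forall t, 0 <= p t) ->
  normc (kern p b c z) = p (z.1 + b * z.2).
Proof. by move=> p0; rewrite Normc.normcM normc_expi mulr1 normc_real ger0_norm. Qed.

Lemma cmeasurable_pair1 d1 d2 (T1 : measurableType d1) (T2 : measurableType d2)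
  (F : T1 * T2 -> R[i]) x : cmeasurable F -> cmeasurable (fun y => F (x, y)).
Proof. by apply: cmeasurable_comp; exact: pair1_measurable. Qed.

Lemma sqnorm_kern p b c x : window p -> b != 0 ->
  (sqnorm (fun u => kern p b c (x, u)) < +oo)%E.
Proof.
move=> wp b0; apply: (window_sqnorm (c := x) wp b0).
  by apply: cmeasurable_pair1; apply: cmeasurable_kern; case: wp.
by move=> t; rewrite normc_kern /= 1?addrC//; case: wp.
Qed.

Lemma cintegrable_corr p b c psi x : window p -> b != 0 -> cmeasurable psi ->
  (sqnorm psi < +oo)%E -> cintegrable (fun u => kern p b c (x, u) * (psi u)^*).
Proof.
move=> wp b0 mpsi psioo; apply: cintegrableM.
- by apply: cmeasurable_pair1; apply: cmeasurable_kern; case: wp.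
- exact: cmeasurable_conj.
- exact: sqnorm_kern.
- by rewrite sqnorm_conj.
Qed.

Lemma fourier1_conj h xi : cintegrable h ->
  (fourier1 h xi)^* = cintegral (fun u => (h u)^* * expi (2 * pi * u * xi)).
Proof.
move=> hi; rewrite -cintegral_conj; last first.
  apply: (le_cintegrable (g := fun t => normc (h t))).
  - apply: cmeasurableM; first exact: cintegrable_measurable.
    apply: cmeasurable_expi; apply: measurable_funN; exact: measurable_funM.
  - exact: integrable_normc.
  - by move=> t; rewrite Normc.normcM normc_expi mulr1.
by apply: eq_cintegral => u; rewrite conjcM expi_conj opprK.
Qed.

(** The variable [y] is centered at the frequency [c]: the profile [P] stays fixed, and the shift by
    [c] falls on the transform of the atom. *)
Definition fkern P (c x y : R) : R[i] := (P y)%:C * expi (2 * pi * (y + c) * x).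

Lemma cmeasurable_fkern P c x : measurable_fun [set: R] P -> cmeasurable (fkern P c x).
Proof.
move=> mP; apply: cmeasurableM; first exact: cmeasurable_real.
apply: cmeasurable_expi; apply: measurable_funM => //; apply: measurable_funM => //.
exact: measurable_funD.
Qed.

Lemma normc_fkern P c x y : (forall t, 0 <= P t) -> normc (fkern P c x y) = P y.
Proof. by move=> P0; rewrite Normc.normcM normc_expi mulr1 normc_real ger0_norm. Qed.

Lemma sqnorm_fkern P c x : window P -> (sqnorm (fkern P c x) < +oo)%E.
Proof.
move=> wP; apply: (window_sqnorm (b := 1) (c := 0) wP (oner_neq0 R)).
  by apply: cmeasurable_fkern; case: wP.
by move=> t; rewrite mul1r addr0 normc_fkern//; case: wP.
Qed.

Definition aff_conj (b c : R) f (y : R) : R[i] := (f (b * (y + c)))^*.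

Lemma cmeasurable_aff_conj b c f : cmeasurable f -> cmeasurable (aff_conj b c f).
Proof.
move=> mf; apply: cmeasurable_conj; apply: cmeasurable_comp mf.
by apply: measurable_funM => //; exact: measurable_funD.
Qed.

Lemma sqnorm_aff_conj b c f : 0 < b -> cmeasurable f ->
  sqnorm (aff_conj b c f) = (b^-1%:E * sqnorm f)%E.
Proof.
move=> b0 mf; rewrite -(sqnorm_conj f) -[in RHS](gtr0_norm b0).
rewrite -(sqnorm_affine (b * c) (lt0r_neq0 b0) (cmeasurable_conj mf)).
by congr sqnorm; apply/funext => y; rewrite /aff_conj mulrDr.
Qed.

(** The integral that represents [p] is inserted and the two integrations are exchanged.
    Integrability of [h] makes the double integral absolutely convergent, with majorant P(y)
    |h(u)|. *)
Lemma corr_fourier1 P p b c h x : window P -> window p -> transform_of P p ->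
  b != 0 -> cintegrable h ->
  corr p b c h x =
  cintegral (fun y => fkern P c x y * aff_conj b c (fourier1 h) y).
Proof.
move=> [mP P0 _ iP] [mp p0 _ ip] Pp b0 hi; have mh := cintegrable_measurable hi.
pose G (z : R * R) := fkern P c x z.1 * ((h z.2)^* * expi (2 * pi * z.2 * (b * (z.1 + c)))).
have mG : cmeasurable G.
  apply: cmeasurableM.
    by apply: cmeasurable_comp (cmeasurable_fkern c x mP); exact: measurable_fst.
  apply: cmeasurableM.
    by apply: cmeasurable_comp (cmeasurable_conj mh); exact: measurable_snd.
  apply: cmeasurable_expi; apply: measurable_funM; first exact: measurable_funM.
  by apply: measurable_funM => //; exact: measurable_funD.
have ih : cintegrable (fun u => (h u)^* ) by exact: cintegrable_conj.
have ihe y : cintegrable (fun u => (h u)^* * expi (2 * pi * u * (b * (y + c)))).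
  apply: (le_cintegrable (g := fun t => normc (h t))).
  - apply: cmeasurableM; first exact: cmeasurable_conj.
    apply: cmeasurable_expi; apply: measurable_funM => //; exact: measurable_funM.
  - exact: integrable_normc.
  - by move=> t; rewrite Normc.normcM normc_expi mulr1 normc_conj.
have Goo : (\int[mu]_y \int[mu]_u (normc (G (y, u)))%:E < +oo)%E.
  apply: (tensor_lty (a1 := P) (a2 := fun u => normc (h u)) (F := fun z => (normc (G z))%:E)) => //.
  - by apply/measurable_EFinP; exact: cmeasurable_normc.
  - by move=> z; rewrite lee_fin normc_ge0.
  - by move=> y u; rewrite !Normc.normcM -Normc.normcM normc_fkern// normc_expi mulr1 normc_conj.
  - exact: integrable_normc.
have [_ e] := cintegral_fubini mG Goo.
transitivity (cintegral (fun y => cintegral (fun u => G (y, u)))); last first.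
  apply: eq_cintegral => y; rewrite /aff_conj fourier1_conj; last exact: hi.
  rewrite -[RHS]cintegralZl; last exact: ihe.
  exact: erefl.
rewrite e; apply: eq_cintegral => u; rewrite /kern /= Pp.
rewrite mulrAC mulrC [RHS](_ : _ =
  cintegral (fun y => expi (2 * pi * c * (x + b * u)) * (h u)^* *
    ((P y)%:C * expi (2 * pi * y * (x + b * u))))).
  rewrite [RHS]cintegralZl; first by rewrite [X in _ * X]mulrC mulrA.
  apply: (le_cintegrable (g := P)); [|exact: iP|].
    apply: cmeasurableM; first exact: cmeasurable_real.
    by apply: cmeasurable_expi; apply: measurable_funM => //; exact: measurable_funM.
  by move=> y; rewrite Normc.normcM normc_expi mulr1 normc_real ger0_norm.
apply: eq_cintegral => y; rewrite /G /fkern /=.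
(* The two products of exponentials share the phase [2 * pi * (y + c) * (x + b * u)]. *)
have -> : expi (2 * pi * c * (x + b * u)) * (h u)^* * ((P y)%:C * expi (2 * pi * y * (x + b * u))) =
  (P y)%:C * (h u)^* * (expi (2 * pi * c * (x + b * u)) * expi (2 * pi * y * (x + b * u))) by ring.
have -> : (P y)%:C * expi (2 * pi * (y + c) * x) * ((h u)^* * expi (2 * pi * u * (b * (y + c)))) =
  (P y)%:C * (h u)^* * (expi (2 * pi * (y + c) * x) * expi (2 * pi * u * (b * (y + c)))) by ring.
by rewrite -!expiD; congr (_ * expi _); ring.
Qed.

(** At fixed [x] both [kern] and [fkern] are square-integrable, so the two sides depend continuously
    on [psi] and [psihat] in L^2, and the identity survives the limit along the approximations. *)
Lemma corr_fourier P p b c psi psihat x : window P -> window p -> transform_of P p ->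
  0 < b -> is_fourier2 psi psihat ->
  corr p b c psi x =
  cintegral (fun y => fkern P c x y * aff_conj b c psihat y).
Proof.
move=> wP wp Pp b_gt0 /is_fourier2_approx[mpsi mpsih psioo psihoo approx].
have b0 : b != 0 by rewrite gt_eqF.
apply/eqP; rewrite -subr_eq0; apply/eqP.
have mP : measurable_fun [set: R] P by case: wP.
have mp : measurable_fun [set: R] p by case: wp.
pose k1 u := kern p b c (x, u).
have mk1 : cmeasurable k1 by apply: cmeasurable_pair1; exact: cmeasurable_kern.
have mk2 := cmeasurable_fkern c x mP.
have k1oo : (sqnorm k1 < +oo)%E by exact: sqnorm_kern.
have k2oo := sqnorm_fkern c x wP.
(* The first summand bounds the error in [psi], the second the error in [psihat]; the factor [b^-1]
   comes from the dilation inside [aff_conj]. *)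
apply: (normc_eq0_le_eps (C := (fine (sqnorm k1) + 1) + (fine (sqnorm (fkern P c x)) + b^-1))).
move=> e e0; have [h [hi hoo fh gh]] := approx e e0.
have mh := cintegrable_measurable hi.
have mfh := cmeasurable_fourier1 mh.
have [_ le1] : cintegrable (fun t => k1 t * (h t)^*) /\
    normc (cintegral (fun t => k1 t * (psi t)^*) - cintegral (fun t => k1 t * (h t)^*)) <=
    e * (fine (sqnorm k1) + 1).
  apply: cintegralM_close => //; [exact: cmeasurable_conj|exact: cmeasurable_conj|
    by rewrite sqnorm_conj|].
  rewrite mul1r (_ : sqnorm _ = sqnorm (fun t => psi t - h t))//.
  by rewrite -[RHS]sqnorm_conj; congr sqnorm; apply/funext => t; rewrite conjcB.
have [_ le2] : cintegrable (fun t => fkern P c x t * aff_conj b c (fourier1 h) t) /\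
    normc (cintegral (fun t => fkern P c x t * aff_conj b c psihat t) -
      cintegral (fun t => fkern P c x t * aff_conj b c (fourier1 h) t)) <=
    e * (fine (sqnorm (fkern P c x)) + b^-1).
  apply: cintegralM_close => //; [exact: cmeasurable_aff_conj|exact: cmeasurable_aff_conj| |].
    by rewrite sqnorm_aff_conj// lte_mul_pinfty// lee_fin invr_ge0 ltW.
  rewrite (_ : (fun t => _) = aff_conj b c (fun t => psihat t - fourier1 h t)); last first.
    by apply/funext => t; rewrite /aff_conj conjcB.
  rewrite sqnorm_aff_conj//; last exact: cmeasurableB.
  by rewrite EFinM lee_wpmul2l// lee_fin invr_ge0 ltW.
rewrite mulrDr -(subrKA (corr p b c h x)).
rewrite {2}(corr_fourier1 c x wP wp Pp b0 hi).
apply: (le_trans (le_normcD _ _)); apply: lerD => //.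
by rewrite -normcN opprB.
Qed.

End windowed_correlation.

(** * Norm bounds and transforms of the coefficients *)

Section correlation_pairing.
Local Notation "z ^*" := (conjc z) : ring_scope.
Context {R : realType}.
Local Notation mu := (@lebesgue_measure R).
Implicit Types (f g h k psi phi : R -> R[i]) (p q P Q : R -> R).

Lemma cmeasurable_corr p b c psi : measurable_fun [set: R] p -> cmeasurable psi ->
  cmeasurable (corr p b c psi).
Proof.
move=> mp mpsi.
apply: (cmeasurable_cintegral_snd (F := fun z => kern p b c z * (psi z.2)^*)).
apply: cmeasurableM; first exact: cmeasurable_kern.
by apply: cmeasurable_comp (cmeasurable_conj mpsi); exact: measurable_snd.
Qed.

(** The constant is uniform in [psi]. Applied to a difference [phi - h], the bound turns L^2
    approximation of [phi] into L^2 approximation of its coefficients. *)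
Lemma sqnorm_corr p b c : window p -> 0 < b -> exists2 C, 0 <= C &
  forall psi, cmeasurable psi -> (sqnorm psi < +oo)%E ->
  (sqnorm (corr p b c psi) <= C%:E * sqnorm psi)%E.
Proof.
move=> wp b_gt0; have [mp p0 _ ip] := wp.
have b0 : b != 0 by rewrite gt_eqF.
have pfin : (\int[mu]_t (p t)%:E)%E \is a fin_num by exact: integrable_fin_num.
(* Adding 1 makes [I] positive, as the kernel bound requires, even for a window that vanishes almost
   everywhere. *)
pose I := fine (\int[mu]_t (p t)%:E)%E + 1.
have I0 : 0 < I.
  by rewrite ltr_wpDl// fine_ge0// integral_ge0// => t _; rewrite lee_fin.
exists (4 * I ^+ 2 / b); first by rewrite divr_ge0 ?mulr_ge0 ?sqr_ge0// ltW.
move=> psi mpsi psioo; rewrite -(sqnorm_conj psi).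
apply: (sqnorm_kernel_le b_gt0 I0 mp p0).
- by rewrite /I EFinD fineK// leeDl// lee_fin.
- exact: cmeasurable_kern.
- by move=> x u; rewrite normc_kern.
- exact: cmeasurable_conj.
- by move=> x; exact: cintegrable_corr.
Qed.

Lemma kern_lty p b c h : window p -> b != 0 -> cintegrable h ->
  (\int[mu]_u \int[mu]_x (normc (kern p b c (x, u) * (h u)^*))%:E < +oo)%E.
Proof.
move=> [mp p0 _ ip] b0 hi.
have ih := integrable_normc hi.
have pfin : (\int[mu]_t (p t)%:E)%E \is a fin_num by exact: integrable_fin_num.
rewrite (_ : (fun u => _) =
    (fun u => (\int[mu]_t (p t)%:E) * (normc (h u))%:E)%E); last first.
  apply/funext => u.
  have mpu : measurable_fun [set: R] (fun x => (p (x + b * u)%R)%:E).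
    by apply/measurable_EFinP; apply: (measurableT_comp mp); exact: measurable_funD.
  under eq_integral do rewrite Normc.normcM normc_conj normc_kern//= EFinM muleC.
  rewrite ge0_integralZl//=; [|by move=> x _; rewrite lee_fin|by rewrite lee_fin normc_ge0].
  rewrite muleC; congr (_ * _)%E.
  under eq_integral do rewrite -[X in (X + _)%R]mul1r.
  rewrite (ge0_integral_affine (b * u) (oner_neq0 R) (f := EFin \o p)) => [||t]; last 2 first.
  - exact/measurable_EFinP.
  - by rewrite lee_fin.
  by rewrite normr1 invr1 mul1e.
rewrite -(fineK pfin) integralZl// lte_mul_pinfty ?lee_fin//.
- by rewrite fine_ge0// integral_ge0// => t _; rewrite lee_fin.
- exact: integrable_lty.
Qed.

Lemma fubini_tonelli_normc (F : R * R -> R[i]) : cmeasurable F ->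
  (\int[mu]_x \int[mu]_y (normc (F (x, y)))%:E =
   \int[mu]_y \int[mu]_x (normc (F (x, y)))%:E)%E.
Proof.
move=> mF; apply: (fubini_tonelli (m1 := mu) (m2 := mu) (fun z => (normc (F z))%:E)).
  by apply/measurable_EFinP; exact: cmeasurable_normc.
by move=> z; rewrite lee_fin normc_ge0.
Qed.

Lemma cintegrable_corr_fourier q b c h : window q -> b != 0 -> cintegrable h ->
  cintegrable (corr q b c h).
Proof.
move=> wq b0 hi; have [mq _ _ _] := wq.
have mG : cmeasurable (fun z : R * R => kern q b c z * (h z.2)^*).
  apply: cmeasurableM; first exact: cmeasurable_kern.
  apply: cmeasurable_comp (cmeasurable_conj (cintegrable_measurable hi)).
  exact: measurable_snd.
apply: (cintegral_fubini mG _).1.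
rewrite (fubini_tonelli_normc mG); exact: (kern_lty c wq b0 hi).
Qed.

(** After Fubini the integral over [x] is the inner one. The substitution of [x + b * u] turns it
    into the transform of [q] at [y], free of [u], and the remaining phase is that of [fourier1 h]
    at [b * (y + c)]. *)
Lemma cintegral_expi_corr q Q b c h y : window q -> transform_of q Q ->
  b != 0 -> cintegrable h -> (forall x, cintegrable (fun u => kern q b c (x, u) * (h u)^*)) ->
  cintegral (fun x => expi (2 * pi * (y + c) * x) * (corr q b c h x)^*) =
  (Q y)%:C * fourier1 h (b * (y + c)).
Proof.
move=> wq qQ b0 hi hk; have [mq q0 _ iq] := wq; have mh := cintegrable_measurable hi.
pose G (z : R * R) := expi (2 * pi * (y + c) * z.1) * (kern q b c z * (h z.2)^*)^*.
have mk : cmeasurable (fun z : R * R => kern q b c z * (h z.2)^*).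
  apply: cmeasurableM; first exact: cmeasurable_kern.
  by apply: cmeasurable_comp (cmeasurable_conj mh); exact: measurable_snd.
have mG : cmeasurable G.
  apply: cmeasurableM; last exact: cmeasurable_conj.
  by apply: cmeasurable_expi; exact: measurable_funM.
have Goo : (\int[mu]_x \int[mu]_u (normc (G (x, u)))%:E < +oo)%E.
  under eq_integral do under eq_integral do
    rewrite /G Normc.normcM normc_expi mul1r normc_conj.
  rewrite (fubini_tonelli_normc mk); exact: (kern_lty c wq b0 hi).
transitivity (cintegral (fun x => cintegral (fun u => G (x, u)))).
  apply: eq_cintegral => x; rewrite /corr -cintegral_conj; last exact: hk.
  by rewrite -[LHS]cintegralZl; last exact: (cintegrable_conj (hk x)).
rewrite (cintegral_fubini mG Goo).2 /fourier1 -[RHS]cintegralZl; last first.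
  apply: (le_cintegrable (g := fun t => normc (h t))).
  - apply: cmeasurableM => //; apply: cmeasurable_expi; apply: measurable_funN.
    by apply: measurable_funM => //; exact: measurable_funM.
  - exact: integrable_normc.
  - by move=> t; rewrite Normc.normcM normc_expi mulr1.
apply: eq_cintegral => u.
have iqe : cintegrable (fun t => (q t)%:C * expi (2 * pi * t * y)).
  apply: (le_cintegrable (g := q)); [|exact: iq|].
    apply: cmeasurableM; first exact: cmeasurable_real.
    by apply: cmeasurable_expi; apply: measurable_funM => //; exact: measurable_funM.
  by move=> t; rewrite Normc.normcM normc_expi mulr1 normc_real ger0_norm.
rewrite qQ.
have := cintegral_affine (b * u) (oner_neq0 R) iqe.
rewrite normr1 invr1 mul1r => <-.
rewrite -[RHS]cintegralZr; last exact: (cintegrable_affine (b * u) (oner_neq0 R) iqe).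
apply: eq_cintegral => x; rewrite /G /kern /=.
rewrite !conjcM conjcK conjc_real expi_conj mul1r.
have -> : expi (2 * pi * (y + c) * x) *
    ((q (x + b * u))%:C * expi (- (2 * pi * c * (x + b * u))) * h u) =
  (q (x + b * u))%:C * h u * (expi (2 * pi * (y + c) * x) * expi (- (2 * pi * c * (x + b * u)))) by ring.
have -> : (q (x + b * u))%:C * expi (2 * pi * (x + b * u) * y) *
    (h u * expi (- (2 * pi * u * (b * (y + c))))) =
  (q (x + b * u))%:C * h u * (expi (2 * pi * (x + b * u) * y) * expi (- (2 * pi * u * (b * (y + c))))) by ring.
by rewrite -!expiD; congr (_ * expi _); ring.
Qed.

End correlation_pairing.

(** * Plancherel for pairs of coefficients *)

Section pairing.
Local Notation "z ^*" := (conjc z) : ring_scope.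
Context {R : realType}.
Local Notation mu := (@lebesgue_measure R).
Implicit Types (f g h k psi phi : R -> R[i]) (p q P Q : R -> R).

(** Fubini applies because the coefficients of an integrable [h] are integrable in [x]. For a
    general function of L^2 they are only known to be square-integrable, which is why the second
    factor is treated by approximation. *)
Lemma pairing_fourier1 P p q Q b c psi psihat h :
  window P -> window p -> window q -> transform_of P p -> transform_of q Q ->
  0 < b -> is_fourier2 psi psihat -> cintegrable h -> (sqnorm h < +oo)%E ->
  cintegral (fun x => corr p b c psi x * (corr q b c h x)^*) =
  cintegral (fun y => (P y * Q y)%:C * (aff_conj b c psihat y * (aff_conj b c (fourier1 h) y)^*)).
Proof.
move=> wP wp wq Pp qQ b_gt0 F2 hi hoo.
have b0 : b != 0 by rewrite gt_eqF.
have [mP P0 _ iP] := wP; have [mq q0 _ iq] := wq.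
have [mpsi mpsih psioo psihoo _] := is_fourier2_approx F2.
have mh := cintegrable_measurable hi.
have hk x := cintegrable_corr c x wq b0 mh hoo.
have mA := cmeasurable_aff_conj b c mpsih.
have Aoo : (sqnorm (aff_conj b c psihat) < +oo)%E.
  by rewrite sqnorm_aff_conj// lte_mul_pinfty// lee_fin invr_ge0 ltW.
have ik x : cintegrable (fun y => fkern P c x y * aff_conj b c psihat y).
  by apply: cintegrableM => //; [exact: cmeasurable_fkern|exact: sqnorm_fkern].
have iV := cintegrable_corr_fourier c wq b0 hi.
pose G (z : R * R) := fkern P c z.1 z.2 * aff_conj b c psihat z.2 * (corr q b c h z.1)^*.
have mf2 : cmeasurable (fun z : R * R => fkern P c z.1 z.2).
  apply: cmeasurableM.
    by apply: cmeasurable_real; apply: (measurableT_comp mP); exact: measurable_snd.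
  apply: cmeasurable_expi; apply: measurable_funM => //; apply: measurable_funM => //.
  exact: measurable_funD.
have mG : cmeasurable G.
  apply: cmeasurableM.
    by apply: cmeasurableM => //; apply: cmeasurable_comp mA; exact: measurable_snd.
  apply: cmeasurable_conj; apply: (cmeasurable_comp (F := corr q b c h)).
    exact: measurable_fst.
  exact: cintegrable_measurable.
have nk x y : normc (fkern P c x y * aff_conj b c psihat y) = P y * normc (aff_conj b c psihat y).
  by rewrite Normc.normcM normc_fkern.
have Goo : (\int[mu]_x \int[mu]_y (normc (G (x, y)))%:E < +oo)%E.
  apply: (tensor_lty (a1 := fun x => normc (corr q b c h x))
    (a2 := fun y => normc (fkern P c 0 y * aff_conj b c psihat y)) (F := fun z => (normc (G z))%:E)).
  - by apply/measurable_EFinP; exact: cmeasurable_normc.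
  - by move=> z; rewrite lee_fin normc_ge0.
  - by move=> x y; rewrite lee_fin /G Normc.normcM normc_conj !nk mulrC.
  - exact: integrable_normc iV.
  - exact: integrable_normc (ik 0).
transitivity (cintegral (fun x => cintegral (fun y => G (x, y)))).
  apply: eq_cintegral => x; rewrite (corr_fourier c x wP wp Pp b_gt0 F2).
  by rewrite -[LHS]cintegralZr; last exact: ik.
rewrite (cintegral_fubini mG Goo).2; apply: eq_cintegral => y.
have e := cintegral_expi_corr y wq qQ b0 hi hk.
have iE : cintegrable (fun x => expi (2 * pi * (y + c) * x) * (corr q b c h x)^*).
  apply: (le_cintegrable (g := fun x => normc (corr q b c h x))).
  - apply: cmeasurableM; last by apply: cmeasurable_conj; exact: cintegrable_measurable.
    by apply: cmeasurable_expi; exact: measurable_funM.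
  - exact: integrable_normc.
  - by move=> x; rewrite Normc.normcM normc_expi mul1r normc_conj.
transitivity (((P y)%:C * aff_conj b c psihat y) *
   cintegral (fun x => expi (2 * pi * (y + c) * x) * (corr q b c h x)^*)).
  rewrite -[RHS]cintegralZl; last exact: iE.
  apply: eq_cintegral => x; rewrite /G /fkern [(x, y).1]/= [(x, y).2]/=.
  by move: (expi _) (corr _ _ _ _ _) => E C; ring.
rewrite e /aff_conj conjcK.
have -> : (P y * Q y)%:C = (P y)%:C * (Q y)%:C by rewrite rmorphM.
move: (psihat _) (fourier1 _ _) => A B; ring.
Qed.

(** Both sides are continuous in the second function: on the left by the Young bound for [corr q],
    on the right because [P * Q] is a bounded factor. *)
Lemma pairing_fourier2 P p q Q b c psi psihat phi phihat BQ :
  window P -> window p -> window q -> transform_of P p -> transform_of q Q ->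
  measurable_fun [set: R] Q -> (forall y, `|Q y| <= BQ) ->
  0 < b -> is_fourier2 psi psihat -> is_fourier2 phi phihat ->
  [/\ cintegrable (fun x => corr p b c psi x * (corr q b c phi x)^*),
    cintegrable (fun y => (P y * Q y)%:C * (aff_conj b c psihat y * (aff_conj b c phihat y)^*)) &
    cintegral (fun x => corr p b c psi x * (corr q b c phi x)^*) =
    cintegral (fun y => (P y * Q y)%:C * (aff_conj b c psihat y * (aff_conj b c phihat y)^*))].
Proof.
move=> wP wp wq Pp qQ mQ QB b_gt0 F2 F2'.
have b0 : b != 0 by rewrite gt_eqF.
have [mP P0 [BP PB] iP] := wP; have [mp _ _ _] := wp; have [mq q0 _ iq] := wq.
have [mpsi mpsih psioo psihoo _] := is_fourier2_approx F2.
have [mphi mphih phioo phihoo approx] := is_fourier2_approx F2'.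
have [Cp Cp0 Cp_le] := sqnorm_corr c wp b_gt0.
have [Cq Cq0 Cq_le] := sqnorm_corr c wq b_gt0.
have mV := cmeasurable_corr b c mp mpsi.
have Voo : (sqnorm (corr p b c psi) < +oo)%E.
  by rewrite (le_lt_trans (Cp_le _ mpsi psioo))// lte_mul_pinfty.
have mVq f : cmeasurable f -> cmeasurable (fun x => (corr q b c f x)^*).
  by move=> mf; exact: cmeasurable_conj (cmeasurable_corr b c mq mf).
have Vqoo f : cmeasurable f -> (sqnorm f < +oo)%E ->
    (sqnorm (fun x => (corr q b c f x)^*) < +oo)%E.
  by move=> mf foo; rewrite sqnorm_conj (le_lt_trans (Cq_le _ mf foo))// lte_mul_pinfty.
have BQ0 : 0 <= BQ by exact: le_trans (normr_ge0 (Q 0)) (QB 0).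
have BP0 : 0 <= BP by exact: le_trans (P0 0) (PB 0).
have affoo f : cmeasurable f -> (sqnorm f < +oo)%E -> (sqnorm (aff_conj b c f) < +oo)%E.
  by move=> mf foo; rewrite sqnorm_aff_conj// lte_mul_pinfty// lee_fin invr_ge0 ltW.
have Aoo := affoo _ mpsih psihoo.
pose k y := (P y * Q y)%:C * aff_conj b c psihat y.
have mA := cmeasurable_aff_conj b c mpsih.
have mk : cmeasurable k.
  by apply: cmeasurableM mA; apply: cmeasurable_real; exact: measurable_funM.
(* Multiplication by [P * Q], bounded by [BP * BQ], preserves square-integrability. *)
have koo : (sqnorm k < +oo)%E.
  apply: (@le_lt_trans _ _ (((BP * BQ) ^+ 2)%:E * sqnorm (aff_conj b c psihat))%E).
    rewrite /sqnorm -ge0_integralZl//=; first last.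
    - by rewrite lee_fin sqr_ge0.
    - by move=> y _; rewrite lee_fin sqr_ge0.
    - by apply/measurable_EFinP; apply: measurable_funX; exact: cmeasurable_normc.
    apply: ge0_le_integral => //.
    - by move=> y _; rewrite lee_fin sqr_ge0.
    - by apply/measurable_EFinP; apply: measurable_funX; exact: cmeasurable_normc.
    - apply: emeasurable_funM => //.
      by apply/measurable_EFinP; apply: measurable_funX; exact: cmeasurable_normc.
    - move=> y _; rewrite -EFinM lee_fin Normc.normcM exprMn ler_wpM2r ?sqr_ge0//.
      rewrite normc_real normrM (ger0_norm (P0 y)) lerXn2r ?nnegrE ?mulr_ge0//.
      exact: ler_pM.
  by rewrite lte_mul_pinfty// lee_fin sqr_ge0.
split; first by apply: cintegrableM => //; [exact: mVq|exact: Vqoo].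
  have := cintegrableM mk (cmeasurable_conj (cmeasurable_aff_conj b c mphih)) koo _.
  rewrite sqnorm_conj => /(_ (affoo _ mphih phihoo)).
  by congr cintegrable; apply/funext => y; rewrite /k mulrA.
apply/eqP; rewrite -subr_eq0; apply/eqP.
(* [Cq] is the Young constant for the coefficients of [phi - h], and [b^-1] the dilation factor on
   the Fourier side. *)
apply: (normc_eq0_le_eps (C := (fine (sqnorm (corr p b c psi)) + Cq) + (fine (sqnorm k) + b^-1))).
move=> e e0; have [h [hi hoo fh gh]] := approx e e0.
have mh := cintegrable_measurable hi; have mfh := cmeasurable_fourier1 mh.
have fhoo : (sqnorm (fun t => (phi t - h t)%R) < +oo)%E by rewrite (le_lt_trans fh)// ltry.
have mfmh : cmeasurable (fun t => phi t - h t) by exact: cmeasurableB.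
have [_ le1] : cintegrable (fun x => corr p b c psi x * (corr q b c h x)^*) /\
    normc (cintegral (fun x => corr p b c psi x * (corr q b c phi x)^*) -
      cintegral (fun x => corr p b c psi x * (corr q b c h x)^*)) <=
    e * (fine (sqnorm (corr p b c psi)) + Cq).
  apply: cintegralM_close => //; [exact: mVq|exact: mVq|exact: Vqoo|].
  rewrite (_ : (fun t => _) = (fun x => (corr q b c (fun t => phi t - h t) x)^*)).
    rewrite sqnorm_conj (le_trans (Cq_le _ mfmh fhoo))// EFinM.
    by rewrite lee_wpmul2l// lee_fin.
  apply/funext => x; rewrite -conjcB; congr (_^*).
  rewrite -cintegralB; [|exact: cintegrable_corr|exact: cintegrable_corr].
  by apply: eq_cintegral => u; rewrite conjcB mulrBr.
have [_ le2] : cintegrable (fun y => k y * (aff_conj b c (fourier1 h) y)^*) /\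
    normc (cintegral (fun y => k y * (aff_conj b c phihat y)^*) -
      cintegral (fun y => k y * (aff_conj b c (fourier1 h) y)^*)) <=
    e * (fine (sqnorm k) + b^-1).
  apply: cintegralM_close => //.
  - by apply: cmeasurable_conj; exact: cmeasurable_aff_conj.
  - by apply: cmeasurable_conj; exact: cmeasurable_aff_conj.
  - by rewrite sqnorm_conj; exact: affoo.
  rewrite (_ : (fun t => _) = (fun y => (aff_conj b c (fun t => phihat t - fourier1 h t) y)^*)).
    rewrite sqnorm_conj sqnorm_aff_conj//; last exact: cmeasurableB.
    by rewrite EFinM lee_wpmul2l// lee_fin invr_ge0 ltW.
  by apply/funext => y; rewrite /aff_conj !conjcK.
rewrite mulrDr.
rewrite -(subrKA (cintegral (fun x => corr p b c psi x * (corr q b c h x)^*))).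
rewrite {2}(pairing_fourier1 c wP wp wq Pp qQ b_gt0 F2 hi hoo).
apply: (le_trans (le_normcD _ _)); apply: lerD; first exact: le1.
rewrite -normcN opprB; move: le2; congr (normc (_ - _) <= _);
  by apply: eq_cintegral => y; rewrite /k mulrA.
Qed.

End pairing.

(** * The Poisson kernel and the tested resolution identity *)

Section poisson_kernel.
Context {R : realType}.
Local Notation mu := (@lebesgue_measure R).

Definition laplace (k y : R) := expR (- (k * `|y|)).

Definition poisson (k t : R) := 2 * k / (k ^+ 2 + (2 * pi * t) ^+ 2).

(** Adding 1 to the cosine makes the integrand nonnegative, so that the fundamental theorem on a
    half-line applies without prior integrability. The extra term is subtracted again in
    [Rintegral_laplace_cos]. *)
Lemma integral_expR_cos_half (k s : R) : 0 < k ->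
  (\int[mu]_(y in `[0%R, +oo[) (expR (- (k * y)) * (1 + cos (s * y)))%:E =
   (k^-1 + k / (k ^+ 2 + s ^+ 2))%:E)%E.
Proof.
move=> k0.
have d0 : k ^+ 2 + s ^+ 2 != 0 by rewrite gt_eqF// ltr_wpDr ?sqr_ge0// exprn_gt0.
have kn0 : k != 0 by rewrite gt_eqF.
have kge0 := ltW k0.
(* The antiderivative that tends to 0 at infinity, so that the integral is [- F 0]. *)
pose F y := expR (- (k * y)) *
  ((s * sin (s * y) - k * cos (s * y)) / (k ^+ 2 + s ^+ 2) - k^-1).
have dF (y : R) : is_derive y 1 F (expR (- (k * y)) * (1 + cos (s * y))).
  apply: is_derive_eq.
  rewrite /GRing.scale/=; field; by rewrite kn0 d0.
have cF : continuous F.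
  by move=> y; apply: differentiable_continuous; apply/derivable1_diffP; exact: ex_derive.
rewrite (@ge0_continuous_FTC2y _ _ F _ 0).
- rewrite /F !mulr0 oppr0 expR0 sin0 cos0 -EFinB; congr EFin; field.
  by rewrite kn0 d0.
- by move=> y _; rewrite mulr_ge0 ?expR_ge0// -lerBlDl sub0r cos_geN1.
- apply: continuous_subspaceT => y; apply: differentiable_continuous.
  apply/derivable1_diffP. exact: ex_derive.
- have Ek : expR (- (k * y)) @[y --> +oo] --> 0.
    apply: (@cvg_comp _ _ _ (fun y => k * y) (fun y => expR (- y)) _ (pinfty_nbhs R)).
      exact: gt0_cvgMry.
    exact: cvgr_expR.
  pose C := (`|s| + k) / (k ^+ 2 + s ^+ 2) + k^-1.
  have CE : expR (- (k * y)) * C @[y --> +oo] --> 0.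
    by rewrite -(mul0r C); exact: cvgMl.
  apply: norm_cvg0; apply: (squeeze_cvgr _ (cvg_cst 0) CE).
  apply: nearW => y; rewrite normr_ge0/= /F normrM ger0_norm ?expR_ge0//.
  apply: ler_wpM2l; first exact: expR_ge0.
  apply: (le_trans (ler_normB _ _)); rewrite /C (ger0_norm (x := k^-1)) ?invr_ge0//.
  rewrite lerD2r normrM normfV (ger0_norm (x := k ^+ 2 + s ^+ 2)) ?addr_ge0 ?sqr_ge0//.
  apply: ler_wpM2r; first by rewrite invr_ge0 addr_ge0 ?sqr_ge0.
  apply: (le_trans (ler_normB _ _)); rewrite !normrM (gtr0_norm k0).
  apply: lerD; [apply: ler_piMr => //|apply: ler_piMr; first exact: ltW].
    by rewrite ler_norml sin_geN1 sin_le1.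
  by rewrite ler_norml cos_geN1 cos_le1.
- by move=> y _; exact: ex_derive.
- exact/cvg_at_right_filter/cF.
- by move=> y _; rewrite derive1E; exact: derive_val.
Qed.

Lemma continuous_laplace (k : R) : continuous (laplace k).
Proof.
move=> y; apply: continuous_comp; last exact: continuous_expR.
by apply: cvgN; apply: cvgMr; exact: norm_continuous.
Qed.

Lemma measurable_laplace (k : R) : measurable_fun [set: R] (laplace k).
Proof. by apply: continuous_measurable_fun; exact: continuous_laplace. Qed.

Lemma laplace_ge0 (k y : R) : 0 <= laplace k y. Proof. exact: expR_ge0. Qed.

Lemma integral_laplace_cos (k s : R) : 0 < k ->
  (\int[mu]_y (laplace k y * (1 + cos (s * y)))%:E =
   (2 * (k^-1 + k / (k ^+ 2 + s ^+ 2)))%:E)%E.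
Proof.
move=> k0; rewrite (ge0_symfun_integralT (f := fun y => laplace k y * (1 + cos (s * y)))).
- rewrite -set_itvcy EFinM; congr (_ * _)%E.
  rewrite -integral_expR_cos_half//; apply: eq_integral => y.
  by rewrite inE/= in_itv/= andbT => y0; rewrite /laplace ger0_norm.
- by move=> y; rewrite mulr_ge0 ?laplace_ge0// -lerBlDl sub0r cos_geN1.
- move=> y; apply: cvgM; first exact: continuous_laplace.
  apply: cvgD; first exact: cvg_cst.
  apply: continuous_comp; last exact: continuous_cos.
  by apply: cvgMr; exact: cvg_id.
- by move=> y /=; rewrite /laplace normrN mulrN cosN.
Qed.


Lemma laplace_lty (k : R) : 0 < k -> mu.-integrable [set: R] (EFin \o laplace k).
Proof.
move=> k0; apply/integrableP; split; first by apply/measurable_EFinP; exact: measurable_laplace.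
have := integral_laplace_cos 0 k0.
under eq_integral do rewrite mul0r cos0.
move=> e; apply: (@le_lt_trans _ _ (\int[mu]_y (laplace k y * (1 + 1))%:E)%E).
  apply: ge0_le_integral => //.
  - by apply/measurable_EFinP; apply: measurableT_comp => //; exact: measurable_laplace.
  - by apply/measurable_EFinP; apply: measurable_funM => //; exact: measurable_laplace.
  - move=> y _ /=; rewrite lee_fin ger0_norm ?laplace_ge0//.
    by rewrite mulrDr mulr1 lerDl laplace_ge0.
by rewrite e ltry.
Qed.

Lemma laplace_trig_integrable (k s : R) (g : R -> R) : 0 < k ->
  measurable_fun [set: R] g -> (forall y, `|g y| <= 1) ->
  mu.-integrable [set: R] (EFin \o (fun y => laplace k y * g y)).
Proof.
move=> k0 mg g1; apply: le_integrable (laplace_lty k0) => //.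
  by apply/measurable_EFinP; apply: measurable_funM => //; exact: measurable_laplace.
move=> y _ /=; rewrite lee_fin normrM.
by apply: ler_piMr.
Qed.

Lemma Rintegral_laplace_1Dcos (k s : R) : 0 < k ->
  \int[mu]_y (laplace k y) + \int[mu]_y (laplace k y * cos (s * y)) =
  2 * (k^-1 + k / (k ^+ 2 + s ^+ 2)).
Proof.
move=> k0; rewrite -RintegralD//.
- rewrite -[RHS]/(fine _%:E) -(integral_laplace_cos s k0).
  by apply: eq_Rintegral => y _; rewrite mulrDr mulr1.
- exact: laplace_lty.
- apply: laplace_trig_integrable => //; last by move=> y; rewrite ler_norml cos_geN1 cos_le1.
  apply: continuous_measurable_fun => y.
  apply: continuous_comp; last exact: continuous_cos.
  by apply: cvgMr; exact: cvg_id.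
Qed.

Lemma Rintegral_laplace_cos (k s : R) : 0 < k ->
  \int[mu]_y (laplace k y * cos (s * y)) = 2 * k / (k ^+ 2 + s ^+ 2).
Proof.
(* At [s = 0] the formula gives twice the integral of [laplace k], which is then eliminated from the
   formula at [s]. *)
move=> k0; have := Rintegral_laplace_1Dcos s k0; have := Rintegral_laplace_1Dcos 0 k0.
under [X in _ + X]eq_Rintegral do rewrite mul0r cos0 mulr1.
set I := (\int[mu]_y _); set J := (\int[mu]_y _).
have -> : k / (k ^+ 2 + 0 ^+ 2) = k^-1 by rewrite expr0n/= addr0; field; rewrite gt_eqF.
rewrite -mulrA; move: (k / (k ^+ 2 + s ^+ 2)) => z; lra.
Qed.

Lemma Rintegral_laplace_sin (k s : R) : 0 < k ->
  \int[mu]_y (laplace k y * sin (s * y)) = 0.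
Proof.
move=> k0; have i : mu.-integrable [set: R] (EFin \o (fun y => laplace k y * sin (s * y))).
  apply: laplace_trig_integrable => //; last by move=> y; rewrite ler_norml sin_geN1 sin_le1.
  apply: continuous_measurable_fun => y.
  apply: continuous_comp; last exact: continuous_sin.
  by apply: cvgMr; exact: cvg_id.
have N1 : -1 != 0 :> R by rewrite oppr_eq0 oner_eq0.
have := Rintegral_affine 0 N1 i.
rewrite normrN normr1 invr1 mul1r => e.
suff : \int[mu]_y (laplace k y * sin (s * y)) = - \int[mu]_y (laplace k y * sin (s * y)) by lra.
rewrite -[LHS]e -[RHS]mulN1r -RintegralZl//; apply: eq_Rintegral => y _.
by rewrite addr0 !mulN1r /laplace normrN mulrN sinN mulrN.
Qed.

Lemma transform_laplace (k : R) : 0 < k -> transform_of (laplace k) (poisson k).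
Proof.
move=> k0 t; apply: complex_eq => /=.
  transitivity (\int[mu]_y (laplace k y * cos ((2 * pi * t) * y))).
    by rewrite Rintegral_laplace_cos.
  by apply: eq_Rintegral => y _; rewrite mul0r subr0; congr (_ * cos _); ring.
transitivity (\int[mu]_y (laplace k y * sin ((2 * pi * t) * y))).
  by rewrite Rintegral_laplace_sin.
by apply: eq_Rintegral => y _; rewrite mul0r addr0; congr (_ * sin _); ring.
Qed.

Lemma window_laplace (k : R) : 0 < k -> window (laplace k).
Proof.
move=> k0; split.
- exact: measurable_laplace.
- exact: laplace_ge0.
- by exists 1 => t; rewrite -expR0 ler_expR oppr_le0 mulr_ge0// ltW.
- exact: laplace_lty.
Qed.

Lemma poisson_ge0 (k t : R) : 0 < k -> 0 <= poisson k t.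
Proof.
by move=> k0; rewrite /poisson mulr_ge0 ?invr_ge0 ?addr_ge0 ?sqr_ge0 ?mulr_ge0 // ltW.
Qed.

Lemma poisson_le (k t : R) : 0 < k -> poisson k t <= 2 / k.
Proof.
move=> k0; rewrite /poisson ler_pdivrMr ?ltr_wpDr ?sqr_ge0 ?exprn_gt0//.
have -> : 2 / k * (k ^+ 2 + (2 * pi * t) ^+ 2) = 2 * k + 2 / k * (2 * pi * t) ^+ 2.
  by field; rewrite gt_eqF.
by rewrite lerDl mulr_ge0 ?sqr_ge0// divr_ge0// ltW.
Qed.

Lemma continuous_poisson (k : R) : 0 < k -> continuous (poisson k).
Proof.
move=> k0 t; apply: cvgM; first exact: cvg_cst.
apply: cvgV; first by rewrite gt_eqF// ltr_wpDr ?sqr_ge0 ?exprn_gt0.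
apply: cvgD; first exact: cvg_cst.
apply: (@continuous_comp _ _ _ (fun t => 2 * pi * t) (fun x => x ^+ 2)).
  by apply: cvgMr; exact: cvg_id.
exact: exprn_continuous.
Qed.

Lemma window_poisson (k : R) : 0 < k -> window (poisson k).
Proof.
move=> k0; have mP : measurable_fun [set: R] (poisson k).
  by apply: continuous_measurable_fun; exact: continuous_poisson.
split => //; first by move=> t; exact: poisson_ge0.
  by exists (2 / k) => t; exact: poisson_le.
(* The Poisson kernel is a rescaled multiple of 1 / (1 + t^2), whose integral over a half-line is
   known. *)
have i1 : mu.-integrable [set: R] (EFin \o (fun t => (oneDsqr t)^-1)).
  apply/integrableP; split.
    by apply/measurable_EFinP; apply: continuous_measurable_fun; exact: continuous_oneDsqrV.
  under eq_integral do rewrite /= ger0_norm ?invr_ge0//.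
  rewrite ge0_symfun_integralT.
  - by rewrite -set_itvcy integral0y_oneDsqr -EFinM ltry.
  - by move=> t; rewrite invr_ge0.
  - exact: continuous_oneDsqrV.
  - by move=> t /=; rewrite /oneDsqr sqrrN.
have c0 : 2 * pi / k != 0 :> R by rewrite !mulf_neq0 ?invr_eq0 ?gt_eqF ?pi_gt0.
have := integrableZl measurableT (2 / k) (integrable_affine 0 c0 i1).
apply: eq_integrable => // t _ /=; rewrite -EFinM; congr EFin.
rewrite /poisson /oneDsqr addr0.
have p1 : k ^+ 2 + (2 * pi * t) ^+ 2 != 0 by rewrite gt_eqF// ltr_wpDr ?sqr_ge0 ?exprn_gt0.
have p2 : 1 + (2 * pi / k * t) ^+ 2 != 0 by rewrite gt_eqF// ltr_wpDr ?sqr_ge0.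
have e : k ^+ 2 + (2 * pi * t) ^+ 2 = k ^+ 2 * (1 + (2 * pi / k * t) ^+ 2).
  by field; rewrite gt_eqF.
rewrite e; move: (1 + _ ^+ 2) p2 => D D0.
by field; rewrite D0 gt_eqF.
Qed.

End poisson_kernel.

(** * Atoms and the tested resolution identity *)

Section atoms.
Local Notation "z ^*" := (conjc z) : ring_scope.
Context {R : realType}.
Local Notation mu := (@lebesgue_measure R).
Implicit Types (psi phi : R -> R[i]) (p q P Q : R -> R).

Lemma conjCE (z : R[i]) : Num.conj z = z^*. Proof. by []. Qed.

(** Modulation by [a] is translation on the Fourier side: it moves the test to a neighborhood of the
    frequency [a]. *)
Definition modulated (a : R) p (t : R) : R[i] := (p t)%:C * expi (2 * pi * a * t).

Lemma cmeasurable_modulated a p : measurable_fun [set: R] p -> cmeasurable (modulated a p).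
Proof.
move=> mp; apply: cmeasurableM; first exact: cmeasurable_real.
by apply: cmeasurable_expi; exact: measurable_funM.
Qed.

Lemma normc_modulated a p t : (forall t, 0 <= p t) -> normc (modulated a p t) = p t.
Proof. by move=> p0; rewrite Normc.normcM normc_expi mulr1 normc_real ger0_norm. Qed.

Lemma modulated_cLp1 a p : window p -> cLp 1 (modulated a p).
Proof.
move=> [mp p0 _ ip]; split; first exact: cmeasurable_modulated.
rewrite cnorm1E; under eq_integral do rewrite normc_modulated//.
exact: integrable_lty.
Qed.

Lemma modulated_cLp2 a p : window p -> cLp 2 (modulated a p).
Proof.
move=> wp; have [mp p0 _ ip] := wp; split; first exact: cmeasurable_modulated.
apply/cnorm2_lty; apply: (window_sqnorm (b := 1) (c := 0) wp (oner_neq0 R)).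
  exact: cmeasurable_modulated.
by move=> t; rewrite mul1r addr0 normc_modulated.
Qed.

Lemma beta_gt0 (w : R) : 0 < beta w.
Proof. by rewrite invr_gt0 ltr_wpDr. Qed.

(** The substitution u = (t - x) / beta(w) has Jacobian [beta w]; the other factor is the
    normalization of the dilation. The modulations of the test function and of the atom merge into
    the frequency [a - w]. *)
Lemma inner_atom a p psi x w : window p -> cmeasurable psi -> (sqnorm psi < +oo)%E ->
  inner (modulated a p) (atom psi x w) =
  (beta w * (beta w `^ (- 2^-1)))%:C * corr p (beta w) (a - w) psi x.
Proof.
move=> wp mpsi psioo; have b_gt0 := beta_gt0 w; have b0 := lt0r_neq0 b_gt0.
have iG := cintegrable_corr (a - w) x wp b0 mpsi psioo.
have bV0 : (beta w)^-1 != 0 by rewrite invr_eq0.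
have e := cintegral_affine (- x / beta w) bV0 iG.
rewrite normrV ?unitfE// invrK gtr0_norm// in e.
have -> : (beta w * (beta w `^ (- 2^-1)))%:C =
    (beta w `^ (- 2^-1))%:C * (beta w)%:C by rewrite -rmorphM mulrC.
rewrite /corr -mulrA -e -[RHS]cintegralZl; last exact: (cintegrable_affine (- x / beta w) bV0 iG).
apply: eq_cintegral => t.
rewrite /kern /atom /modulation /translation /dilation /modulated.
have -> : (x, (beta w)^-1 * t + - x / beta w).1 = x by [].
have -> : (x, (beta w)^-1 * t + - x / beta w).2 = (beta w)^-1 * t + - x / beta w by [].
have -> : x + beta w * ((beta w)^-1 * t + - x / beta w) = t by field.
have -> : (beta w)^-1 * t + - x / beta w = (t - x) / beta w by field.
rewrite (gtr0_norm b_gt0) conjCE !conjcM expi_conj conjc_real.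
have -> : expi (2 * pi * (a - w) * t) = expi (2 * pi * a * t) * expi (- (2 * pi * w * t)).
  by rewrite -expiD; congr expi; ring.
by move: (expi _) (expi _) (_%:C) (_%:C) => E1 E2 s pt; ring.
Qed.

Lemma cintegral_resolution a w P p q Q psi phi psihat phihat BQ :
  window P -> window p -> window q -> transform_of P p -> transform_of q Q ->
  measurable_fun [set: R] Q -> (forall y, `|Q y| <= BQ) ->
  is_fourier2 psi psihat -> is_fourier2 phi phihat ->
  complex.Re (cintegral (fun x => inner (modulated a p) (atom psi x w) *
    (inner (modulated a q) (atom phi x w))^*)) =
  \int[mu]_y (P y * Q y * (beta w *
    complex.Re ((psihat (beta w * (y + (a - w))))^* * phihat (beta w * (y + (a - w)))))).
Proof.
move=> wP wp wq Pp qQ mQ QB F2 F2'; have b_gt0 := beta_gt0 w.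
have b_neq0 := lt0r_neq0 b_gt0.
have [mpsi _ psioo _ _] := is_fourier2_approx F2.
have [mphi _ phioo _ _] := is_fourier2_approx F2'.
have [ci cj ck] := pairing_fourier2 (a - w) wP wp wq Pp qQ mQ QB b_gt0 F2 F2'.
have -> : cintegral (fun x => inner (modulated a p) (atom psi x w) *
     (inner (modulated a q) (atom phi x w))^*) =
   (beta w)%:C * cintegral (fun x => corr p (beta w) (a - w) psi x *
     (corr q (beta w) (a - w) phi x)^*).
  rewrite -[RHS]cintegralZl//; apply: eq_cintegral => x.
  rewrite !inner_atom// conjcM conjc_real.
  (* Each inner product carries the square root of [beta w], so the pair produces the factor
     [beta w] of the multiplier. *)
  have -> : (beta w)%:C = (beta w * (beta w `^ (- 2^-1)))%:C * (beta w * (beta w `^ (- 2^-1)))%:C.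
    rewrite -rmorphM; congr (_%:C).
    have -> : beta w * beta w `^ (- 2^-1) * (beta w * beta w `^ (- 2^-1)) =
      beta w ^+ 2 * (beta w `^ (- 2^-1) * beta w `^ (- 2^-1)) by ring.
    rewrite -powRD; last by rewrite b_neq0 implybT.
    rewrite -opprD -mulr2n -(mulr_natr (2^-1)) mulVf ?pnatr_eq0//.
    by rewrite powRN powRr1 ?ltW// expr2 mulfK.
  by move: (corr _ _ _ _ _) (corr _ _ _ _ _) (_%:C) => A B s; ring.
rewrite ck -cintegralZl//; apply: eq_Rintegral => y _.
rewrite /aff_conj conjcK mulrA -rmorphM ReM [complex.Re _%:C]/= [complex.Im _%:C]/= mul0r subr0.
by move: (complex.Re _) => H; ring.
Qed.

(** In the inner product of the two test functions the modulations by [a] cancel, so the right-hand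
    side does not depend on [a]. *)
Lemma resolution_identity psi phi psihat phihat S a k : 0 < k ->
  is_fourier2 psi psihat -> is_fourier2 phi phihat ->
  is_resolution_operator (atom psi) (atom phi) S ->
  (forall f, cLp 2 f -> aeeq (S f) f) ->
  \int[mu]_w (\int[mu]_y (laplace k y * poisson k^-1 y * (beta w *
    complex.Re ((psihat (beta w * (y + (a - w))))^* * phihat (beta w * (y + (a - w))))))) =
  \int[mu]_t (poisson k t * laplace k^-1 t).
Proof.
move=> k0 F2 F2' [[S2 _ _] resS] Sid; have kV0 : 0 < k^-1 by rewrite invr_gt0.
have wp := window_poisson k0; have wq := window_laplace kV0.
have mpq : measurable_fun [set: R] (poisson k^-1) by case: (window_poisson kV0).
have := resS (modulated a (poisson k)) (modulated a (laplace k^-1))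
  (modulated_cLp1 a wp) (modulated_cLp2 a wp) (modulated_cLp1 a wq) (modulated_cLp2 a wq).
move=> [_ _ e].
have {e} := congr1 (@complex.Re R) e.
have -> : complex.Re (inner (S (modulated a (poisson k))) (modulated a (laplace k^-1))) =
    \int[mu]_t (poisson k t * laplace k^-1 t).
  have f2 := modulated_cLp2 a wp.
  rewrite /Rintegral; congr fine; apply: ae_eq_integral => //.
  - have mS : cmeasurable (S (modulated a (poisson k))) by have [] := S2 _ f2.
    have mq := cmeasurable_conj (cmeasurable_modulated a (measurable_laplace k^-1)).
    by apply/measurable_EFinP; exact: (cmeasurableM mS mq).1.
  - apply/measurable_EFinP; apply: measurable_funM; last exact: measurable_laplace.
    by case: wp.
  - have := Sid _ f2; apply: filterS; first exact: (ae_filter_ringOfSetsType mu).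
    move=> t e _; rewrite e; congr EFin.
    rewrite /modulated conjCE conjcM conjc_real expi_conj.
    have -> : (poisson k t)%:C * expi (2 * pi * a * t) *
      ((laplace k^-1 t)%:C * expi (- (2 * pi * a * t))) =
      ((poisson k t)%:C * (laplace k^-1 t)%:C) *
      (expi (2 * pi * a * t) * expi (- (2 * pi * a * t))) by ring.
    by rewrite -expiD subrr expi0 mulr1 -rmorphM.
move=> ->; apply: eq_Rintegral => w _.
rewrite -(cintegral_resolution a w (window_laplace k0) wp wq (transform_laplace k0)
  (transform_laplace kV0) mpq _ F2 F2' (BQ := 2 / k^-1)) => [//|y].
by rewrite ger0_norm ?poisson_ge0// poisson_le.
Qed.

End atoms.

(** * The multiplier as an integral against a weight *)

Section dilation_weight.
Context {R : realType}.
Local Notation mu := (@lebesgue_measure R).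
Implicit Types (k G h : R -> R) (z xi w : R).

Lemma ae_neq (a : R) : {ae mu, forall z : R, z != a}.
Proof.
exists [set a]; split => //; first exact: lebesgue_measure_set1.
by move=> z /= /negP; rewrite negbK => /eqP.
Qed.

(* For fixed [z], the density of the image of Lebesgue measure under
   [w |-> (1 + `|w|) * z + w], i.e. under the solution [xi] of
   [z = beta w * (xi - w)]. *)
Definition weight z xi : R :=
  (if 0 <= (xi - z) * (1 + z) then `|1 + z|^-1 else 0) +
  (if (xi - z) * (1 - z) < 0 then `|1 - z|^-1 else 0).

Definition weight_bound z : R := `|1 + z|^-1 + `|1 - z|^-1.

Lemma weight_ge0 z xi : 0 <= weight z xi.
Proof. by rewrite addr_ge0//; case: ifP. Qed.

Lemma weight_le z xi : weight z xi <= weight_bound z.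
Proof. by apply: lerD; case: ifP. Qed.

Lemma measurable_normrV d (T : measurableType d) (f : T -> R) :
  measurable_fun [set: T] f -> measurable_fun [set: T] (fun t => `|f t|^-1).
Proof.
move=> mf; under eq_fun do rewrite -powR_inv1//.
apply: (measurableT_comp (f := fun x : R => x `^ (-1))); first exact: measurable_powR.
exact: measurableT_comp.
Qed.

Lemma measurable_weight : measurable_fun [set: R * R] (fun p => weight p.1 p.2).
Proof.
have m1 : measurable_fun [set: R * R] (fun p => 1 + p.1) by exact: measurable_funD.
have m2 : measurable_fun [set: R * R] (fun p => 1 - p.1) by exact: measurable_funB.
have m3 : measurable_fun [set: R * R] (fun p => p.2 - p.1) by exact: measurable_funB.
apply: measurable_funD; apply: measurable_fun_ifT => //.
- by apply: measurable_fun_ler => //; exact: measurable_funM.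
- exact: measurable_normrV.
- by apply: measurable_fun_ltr => //; exact: measurable_funM.
- exact: measurable_normrV.
Qed.

Lemma measurable_weight_bound : measurable_fun [set: R] weight_bound.
Proof.
by apply: measurable_funD; apply: measurable_normrV;
  [exact: measurable_funD|exact: measurable_funB].
Qed.

(** On [w >= 0] the new variable satisfies [xi - z = (1 + z) * w], hence [(xi - z) * (1 + z)] is a
    positive square times [w] and has the sign of [w]. This expresses the half-line as a condition
    on [xi] whatever the sign of the slope; on [w < 0] the slope is [1 - z]. *)
Lemma integral_weight k z : measurable_fun [set: R] k -> (forall x, 0 <= k x) ->
  z != 1 -> z != -1 ->
  (\int[mu]_w (k ((1 + `|w|) * z + w)%R)%:E = \int[mu]_xi (k xi * weight z xi)%:E)%E.
Proof.
move=> mk k0 z1 zN1.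
have a1 : 1 + z != 0 by apply: contra zN1 => /eqP e; apply/eqP; lra.
have a2 : 1 - z != 0 by apply: contra z1 => /eqP e; apply/eqP; lra.
pose g1 xi := if 0 <= (xi - z) * (1 + z) then k xi else 0.
pose g2 xi := if (xi - z) * (1 - z) < 0 then k xi else 0.
have mz : measurable_fun [set: R] (fun xi => xi - z) by exact: measurable_funB.
have mg1 : measurable_fun [set: R] g1.
  apply: measurable_fun_ifT => //.
  by apply: measurable_fun_ler => //; exact: measurable_funM.
have mg2 : measurable_fun [set: R] g2.
  apply: measurable_fun_ifT => //.
  by apply: measurable_fun_ltr => //; exact: measurable_funM.
have g10 x : 0 <= g1 x by rewrite /g1; case: ifP.
have g20 x : 0 <= g2 x by rewrite /g2; case: ifP.
transitivity (\int[mu]_w ((g1 ((1 + z) * w + z)%R)%:E + (g2 ((1 - z) * w + z)%R)%:E))%E.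
  apply: eq_integral => w _; rewrite -EFinD; congr EFin.
  rewrite /g1 /g2 !addrK -!mulrA ![w * _]mulrC !mulrA -!expr2.
  have s1 : 0 < (1 + z) ^+ 2 by rewrite exprn_even_gt0.
  have s2 : 0 < (1 - z) ^+ 2 by rewrite exprn_even_gt0.
  have -> : (0 <= (1 + z) ^+ 2 * w) = (0 <= w) by rewrite pmulr_rge0.
  have -> : ((1 - z) ^+ 2 * w < 0) = (w < 0) by rewrite pmulr_rlt0.
  case: (leP 0 w) => w0; rewrite ?addr0 ?add0r; congr k.
    by rewrite ger0_norm//; ring.
  by rewrite ltr0_norm//; ring.
rewrite ge0_integralD//; first last.
- apply/measurable_EFinP; exact: (measurableT_comp mg2 (measurable_affine (1 - z) z)).
- by move=> w _; rewrite lee_fin.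
- apply/measurable_EFinP; exact: (measurableT_comp mg1 (measurable_affine (1 + z) z)).
- by move=> w _; rewrite lee_fin.
rewrite (ge0_integral_affine z a1 (f := EFin \o g1)) => [||t]; last 2 first.
- exact/measurable_EFinP.
- by rewrite lee_fin.
rewrite (ge0_integral_affine z a2 (f := EFin \o g2)) => [||t]; last 2 first.
- exact/measurable_EFinP.
- by rewrite lee_fin.
rewrite -!ge0_integralZl//=; first last.
- by move=> x _; rewrite lee_fin.
- exact/measurable_EFinP.
- by move=> x _; rewrite lee_fin.
- exact/measurable_EFinP.
rewrite -ge0_integralD//; first last.
- by apply: emeasurable_funM => //; exact/measurable_EFinP.
- by move=> x _; rewrite -EFinM lee_fin mulr_ge0.
- by apply: emeasurable_funM => //; exact/measurable_EFinP.
- by move=> x _; rewrite -EFinM lee_fin mulr_ge0.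
apply: eq_integral => x _; rewrite -!EFinM -EFinD; congr EFin.
rewrite /g1 /g2 /weight mulrDr; case: ifP => _; case: ifP => _; ring.
Qed.

Lemma ae_integral_weight k : measurable_fun [set: R] k -> (forall x, 0 <= k x) ->
  {ae mu, forall z : R, (\int[mu]_w (k ((1 + `|w|) * z + w)%R)%:E =
    \int[mu]_xi (k xi * weight z xi)%:E)%E}.
Proof.
move=> mk k0; have := ae_neq 1; have := ae_neq (-1).
apply: filterS2; first exact: (ae_filter_ringOfSetsType mu).
by move=> z zN1 z1; exact: integral_weight.
Qed.

Lemma measurable_beta : measurable_fun [set: R] (@beta R).
Proof.
rewrite (_ : @beta R = (fun w => `|1 + `|w| |^-1)).
  by apply: measurable_normrV; exact: measurable_funD.
by apply/funext => w; rewrite /beta [X in _ = X^-1]ger0_norm// addr_ge0.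
Qed.

Lemma integral_beta_affine k G w : measurable_fun [set: R] k -> measurable_fun [set: R] G ->
  (forall x, 0 <= k x) -> (forall x, 0 <= G x) ->
  (\int[mu]_xi (k xi * (beta w * G (beta w * (xi - w))))%:E =
   \int[mu]_z (k ((1 + `|w|) * z + w)%R * G z)%:E)%E.
Proof.
move=> mk mG k0 G0; have b0 := beta_gt0 w; have bn := lt0r_neq0 b0.
pose phi z := k ((1 + `|w|) * z + w) * G z.
have mphi : measurable_fun [set: R] phi.
  by apply: measurable_funM => //; exact: (measurableT_comp mk (measurable_affine (1 + `|w|) w)).
have p0 x : (0 <= (phi x)%:E)%E by rewrite lee_fin mulr_ge0.
have mEphi : measurable_fun [set: R] (EFin \o phi) by exact/measurable_EFinP.
have e := ge0_integral_affine (- (beta w * w)) bn mEphi p0.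
have e' : (\int[mu]_z (phi z)%:E =
    (beta w)%:E * \int[mu]_x (phi (beta w * x + - (beta w * w)))%:E)%E.
  by rewrite [X in (_ * X)%E]e muleA -EFinM gtr0_norm// mulfV// mul1e.
rewrite -[RHS]/(\int[mu]_z (phi z)%:E)%E e' -ge0_integralZl//=.
- apply: eq_integral => x _; rewrite -EFinM; congr EFin.
  rewrite /phi mulrCA; have -> : beta w * x + - (beta w * w) = beta w * (x - w) by ring.
  congr (_ * (k _ * _)); rewrite mulrA mulfV ?mul1r ?subrK//.
- apply/measurable_EFinP; exact: (measurableT_comp mphi (measurable_affine (beta w) _)).
- by rewrite lee_fin ltW.
Qed.

(** The passage from [xi] to [z] is made at fixed [w], in [integral_beta_affine]; here the order is
    exchanged and [w] is traded for [xi] at fixed [z]. The round trip moves all dependence on [xi]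
    out of [G] and into the weight. *)
Lemma tonelli_weight k G : measurable_fun [set: R] k -> measurable_fun [set: R] G ->
  (forall x, 0 <= k x) -> (forall x, 0 <= G x) ->
  (\int[mu]_w \int[mu]_z (k ((1 + `|w|) * z + w)%R * G z)%:E =
   \int[mu]_z \int[mu]_xi (G z * (k xi * weight z xi))%:E)%E.
Proof.
move=> mk mG k0 G0.
have mkw : measurable_fun [set: R * R] (fun p => k ((1 + `|p.1|) * p.2 + p.1)).
  apply: (measurableT_comp mk); apply: measurable_funD => //; apply: measurable_funM => //.
  by apply: measurable_funD => //; exact: measurableT_comp.
have mF : measurable_fun [set: R * R] (fun p => (k ((1 + `|p.1|) * p.2 + p.1)%R * G p.2)%:E).
  apply/measurable_EFinP; apply: measurable_funM => //.
  exact: (measurableT_comp mG (@measurable_snd _ _ _ _)).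
have mH : measurable_fun [set: R * R] (fun p => (G p.1 * (k p.2 * weight p.1 p.2))%:E).
  apply/measurable_EFinP; apply: measurable_funM.
    exact: (measurableT_comp mG (@measurable_fst _ _ _ _)).
  apply: measurable_funM; last exact: measurable_weight.
  exact: (measurableT_comp mk (@measurable_snd _ _ _ _)).
have F0 p : (0 <= (k ((1 + `|p.1|) * p.2 + p.1)%R * G p.2)%:E)%E by rewrite lee_fin mulr_ge0.
have H0 p : (0 <= (G p.1 * (k p.2 * weight p.1 p.2))%:E)%E.
  by rewrite lee_fin !mulr_ge0// weight_ge0.
rewrite (fubini_tonelli (m1 := mu) (m2 := mu) _ mF)//=.
apply: ge0_ae_eq_integral => //.
- exact: (measurable_fun_fubini_tonelli_G (m1 := mu) _ mF F0).
- exact: (measurable_fun_fubini_tonelli_F (m2 := mu) _ mH H0).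
- by move=> z _; apply: integral_ge0 => w _; exact: (F0 (w, z)).
- by move=> z _; apply: integral_ge0 => w _; exact: (H0 (z, w)).
have := ae_integral_weight mk k0; apply: filterS; first exact: (ae_filter_ringOfSetsType mu).
move=> z e _.
under eq_integral do rewrite mulrC EFinM.
rewrite ge0_integralZl//=; first last.
- by rewrite lee_fin.
- by move=> w _; rewrite lee_fin.
- apply/measurable_EFinP; apply: (measurableT_comp mk); apply: measurable_funD => //.
  by apply: measurable_funM => //; apply: measurable_funD => //; exact: measurableT_comp.
rewrite e; under [RHS]eq_integral do rewrite EFinM.
rewrite ge0_integralZl//=.
- apply/measurable_EFinP; apply: measurable_funM => //.
  exact: (measurableT_comp measurable_weight (@pair1_measurable _ _ _ _ z)).
- by move=> xi _; rewrite lee_fin mulr_ge0// weight_ge0.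
- by rewrite lee_fin.
Qed.

End dilation_weight.

(** * Integrability against the supremum of the weight *)

Section weight_integrability.
Context {R : realType}.
Local Notation mu := (@lebesgue_measure R).
Implicit Types (k G h : R -> R) (z xi w : R).

Lemma ae_exists_itv (P : R -> Prop) (a b : R) : a < b ->
  {ae mu, forall x, P x} -> exists2 x, a < x < b & P x.
Proof.
move=> ab [N [mN N0 PN]]; apply: contrapT => nP.
have sub : `]a, b[%classic `<=` N.
  move=> x; rewrite /= in_itv/= => xab; apply: PN => /= Px; apply: nP.
  by exists x.
have := le_measure mu (mem_set (measurable_itv `]a, b[)) (mem_set mN) sub.
rewrite [X in (_ <= X)%E]N0 /= lebesgue_measure_itv/= lte_fin ab -EFinB lee_fin.
by rewrite leNgt subr_gt0 ab.
Qed.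

(** For [z] in [[-2, 2]] the differences [xi1 - z] and [xi2 - z] have opposite signs, so each of the
    two terms of the bound is attained in one of the two weights. Outside this interval each term is
    at most 1. *)
Lemma weight_bound_le z xi1 xi2 : 2 < xi1 -> xi2 < - 2 ->
  weight_bound z <= weight z xi1 + weight z xi2 + 2.
Proof.
move=> x1 x2; rewrite /weight_bound.
have [z2|z2] := leP `|z| 2; last first.
  have n1 : `|1 + z|^-1 <= 1.
    rewrite invf_le1; last first.
      move: z2; case: (ltrP z 0) => ?; [rewrite ltr0_norm//|rewrite ger0_norm//] => ?;
        by rewrite normr_gt0; apply/eqP; lra.
    move: z2; have [?|?] := ltrP z 0.
      by rewrite ltr0_norm// => ?; rewrite ltr0_norm; lra.
    by rewrite ger0_norm// => ?; rewrite ger0_norm; lra.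
  have n2 : `|1 - z|^-1 <= 1.
    rewrite invf_le1; last first.
      move: z2; case: (ltrP z 0) => ?; [rewrite ltr0_norm//|rewrite ger0_norm//] => ?;
        by rewrite normr_gt0; apply/eqP; lra.
    move: z2; have [?|?] := ltrP z 0.
      by rewrite ltr0_norm// => ?; rewrite ger0_norm; lra.
    by rewrite ger0_norm// => ?; rewrite ltr0_norm; lra.
  by have := weight_ge0 z xi1; have := weight_ge0 z xi2; lra.
move: z2; rewrite ler_norml => /andP[z2 z2'].
have e1 : `|1 + z|^-1 <= (if 0 <= (xi1 - z) * (1 + z) then `|1 + z|^-1 else 0) +
    (if 0 <= (xi2 - z) * (1 + z) then `|1 + z|^-1 else 0).
  have [p|p] := leP 0 ((xi1 - z) * (1 + z)); first by rewrite lerDl; case: ifP.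
  have : 1 + z < 0 by rewrite -(pmulr_rlt0 _ (x := xi1 - z))//; lra.
  by move=> ?; rewrite add0r ifT// nmulr_rge0; lra.
have e2 : `|1 - z|^-1 <= (if (xi1 - z) * (1 - z) < 0 then `|1 - z|^-1 else 0) +
    (if (xi2 - z) * (1 - z) < 0 then `|1 - z|^-1 else 0).
  have [p|p] := ltP ((xi1 - z) * (1 - z)) 0; first by rewrite lerDl; case: ifP.
  have : 0 <= 1 - z by rewrite -(pmulr_rge0 _ (x := xi1 - z))//; lra.
  rewrite le_eqVlt => /predU1P[<-|?]; first by rewrite normr0 invr0 add0r; case: ifP.
  by rewrite add0r ifT// pmulr_llt0//; lra.
by rewrite /weight; lra.
Qed.

(** The bound is singular at [z = 1] and [z = -1], so integrability of [G] alone is not enough. The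
    finiteness of the integral over [w] is transferred to the integral of [G z * weight z xi] over
    [z] for almost every [xi], and two such [xi] control both singularities. *)
Lemma integrable_weight_bound G : measurable_fun [set: R] G -> (forall x, 0 <= G x) ->
  mu.-integrable [set: R] (EFin \o G) ->
  {ae mu, forall xi, (\int[mu]_w (G (beta w * (xi - w)) * beta w)%:E < +oo)%E} ->
  mu.-integrable [set: R] (EFin \o (fun z => G z * weight_bound z)).
Proof.
move=> mG G0 iG hM.
pose M xi := (\int[mu]_w (beta w * G (beta w * (xi - w)))%:E)%E.
have mb := @measurable_beta R.
have b0 w : 0 <= beta w := ltW (beta_gt0 w).
have mbx : measurable_fun [set: R * R] (fun p => (beta p.2 * G (beta p.2 * (p.1 - p.2)))%:E).
  have mb2 : measurable_fun [set: R * R] (fun p => beta p.2).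
    exact: (measurableT_comp mb (@measurable_snd _ _ _ _)).
  apply/measurable_EFinP; apply: measurable_funM => //; apply: (measurableT_comp mG).
  by apply: measurable_funM => //; exact: measurable_funB.
have bx0 p : (0 <= (beta p.2 * G (beta p.2 * (p.1 - p.2)))%:E)%E.
  by rewrite lee_fin mulr_ge0.
have mM : measurable_fun [set: R] M.
  exact: (measurable_fun_fubini_tonelli_F (m2 := mu) _ mbx bx0).
have M0 xi : (0 <= M xi)%E by apply: integral_ge0 => w _; rewrite lee_fin mulr_ge0.
have M1 xi : 0 < 1 + fine (M xi) by rewrite ltr_pwDl// fine_ge0.
(* [M] is finite almost everywhere but need not be integrable. This density is positive everywhere
   and satisfies [k * M <= laplace 1] wherever [M] is finite, so Tonelli applies and no point is
   lost when [k xi] is divided out. *)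
pose k xi := laplace 1 xi * `|1 + fine (M xi)|^-1.
have k_gt0 xi : 0 < k xi by rewrite mulr_gt0 ?expR_gt0// invr_gt0 normr_gt0 gt_eqF.
have k0 xi : 0 <= k xi := ltW (k_gt0 xi).
have mk : measurable_fun [set: R] k.
  apply: measurable_funM; first exact: measurable_laplace.
  apply: measurable_normrV; apply: measurable_funD => //.
  exact: measurableT_comp.
have mkb : measurable_fun [set: R * R] 
    (fun p => (k p.1 * (beta p.2 * G (beta p.2 * (p.1 - p.2))))%:E).
  apply/measurable_EFinP; apply: measurable_funM.
    exact: (measurableT_comp mk (@measurable_fst _ _ _ _)).
  exact/measurable_EFinP.
have kb0 p : (0 <= (k p.1 * (beta p.2 * G (beta p.2 * (p.1 - p.2))))%:E)%E.
  by rewrite lee_fin mulr_ge0// mulr_ge0.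
have mGk : measurable_fun [set: R * R] (fun p => (G p.1 * (k p.2 * weight p.1 p.2))%:E).
  apply/measurable_EFinP; apply: measurable_funM.
    exact: (measurableT_comp mG (@measurable_fst _ _ _ _)).
  apply: measurable_funM; last exact: measurable_weight.
  exact: (measurableT_comp mk (@measurable_snd _ _ _ _)).
have Gk0 p : (0 <= (G p.1 * (k p.2 * weight p.1 p.2))%:E)%E.
  by rewrite lee_fin mulr_ge0// mulr_ge0// weight_ge0.
pose N xi := (\int[mu]_z (G z * (k xi * weight z xi))%:E)%E.
have mN : measurable_fun [set: R] N.
  exact: (measurable_fun_fubini_tonelli_G (m1 := mu) _ mGk Gk0).
have N0 xi : (0 <= N xi)%E.
  by apply: integral_ge0 => z _; exact: (Gk0 (z, xi)).
have kMe xi : (\int[mu]_w (k xi * (beta w * G (beta w * (xi - w))))%:E = (k xi)%:E * M xi)%E.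
  under eq_integral do rewrite EFinM.
  rewrite ge0_integralZl//=.
  - apply: (measurableT_comp mbx (@pair1_measurable _ _ _ _ xi)).
  - by move=> w _; exact: (bx0 (xi, w)).
  - by rewrite lee_fin.
have Noo : (\int[mu]_xi N xi < +oo)%E.
  rewrite /N -(fubini_tonelli (m1 := mu) (m2 := mu) _ mGk Gk0)/= -tonelli_weight//.
  under eq_integral do rewrite -integral_beta_affine//.
  rewrite -(fubini_tonelli (m1 := mu) (m2 := mu) _ mkb kb0)/=.
  under eq_integral do rewrite kMe.
  apply: (@le_lt_trans _ _ (\int[mu]_xi (laplace 1 xi)%:E)%E); last first.
    exact: (integrable_lty measurableT (laplace_lty ltr01)).
  apply: ae_ge0_le_integral => //.
  - by move=> x _; rewrite mule_ge0// lee_fin.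
  - by apply: emeasurable_funM => //; exact/measurable_EFinP.
  - by move=> x _; rewrite lee_fin laplace_ge0.
  - by apply/measurable_EFinP; exact: measurable_laplace.
  - move: hM; apply: filterS; first exact: (ae_filter_ringOfSetsType mu).
    move=> xi Mxi _.
    have Mfin : M xi \is a fin_num.
      rewrite ge0_fin_numE//; move: Mxi; congr (_ < _)%E.
      by apply: eq_integral => w _; rewrite mulrC.
    rewrite -[X in (_ * X)%E](fineK Mfin) -EFinM lee_fin /k -mulrA ler_piMr ?laplace_ge0//.
    rewrite (gtr0_norm (M1 xi)) mulrC ler_pdivrMr// mul1r lerDr//.
have aeN : {ae mu, forall xi, (\int[mu]_z (G z * weight z xi)%:E < +oo)%E}.
  have iN : mu.-integrable [set: R] N.
    by apply/integrableP; split => //; under eq_integral do rewrite gee0_abs//.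
  have := integrable_ae measurableT iN.
  apply: filterS => xi /= /(_ I); rewrite ge0_fin_numE// => Nxi.
  have mGw : measurable_fun [set: R] (fun z => (G z * weight z xi)%:E).
    apply/measurable_EFinP; apply: measurable_funM => //.
    exact: (measurableT_comp (@measurable_weight R) (@pair2_measurable _ _ _ _ xi)).
  have e : N xi = ((k xi)%:E * \int[mu]_z (G z * weight z xi)%:E)%E.
    rewrite -ge0_integralZl//=.
    - by apply: eq_integral => z _; rewrite -EFinM; congr EFin; ring.
    - by move=> z _; rewrite lee_fin mulr_ge0// weight_ge0.
    - by rewrite lee_fin.
  rewrite ltey; apply/eqP => Ioo; move: Nxi; rewrite e Ioo gt0_muley ?ltxx//.
  by rewrite lte_fin.
(* A property that holds almost everywhere holds somewhere in []2, 3[] and somewhere in []-3, -2[],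
   on the two sides required by [weight_bound_le]. *)
have [xi1 /andP[x1 _] I1] := ae_exists_itv (ltr_nat R 2 3) aeN.
have [xi2 /andP[_ x2] I2] : exists2 x, - 3%:R < x < - 2%:R &
    (\int[mu]_z (G z * weight z x)%:E < +oo)%E.
  by apply: ae_exists_itv aeN; rewrite ltrN2 ltr_nat.
have iw xi : (\int[mu]_z (G z * weight z xi)%:E < +oo)%E ->
    mu.-integrable [set: R] (EFin \o (fun z => G z * weight z xi)).
  move=> Ioo; apply/integrableP; split.
    apply/measurable_EFinP; apply: measurable_funM => //.
    exact: (measurableT_comp (@measurable_weight R) (@pair2_measurable _ _ _ _ xi)).
  by under eq_integral do rewrite /= ger0_norm ?mulr_ge0 ?weight_ge0//.
have := integrableD measurableT (integrableD measurableT (iw _ I1) (iw _ I2))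
  (integrableZl measurableT 2 iG).
apply: le_integrable => //.
  by apply/measurable_EFinP; apply: measurable_funM => //; exact: measurable_weight_bound.
move=> z _; rewrite [leRHS](_ : _ = (`|G z * weight z xi1 + G z * weight z xi2 + 2 * G z|)%:E)//.
rewrite lee_fin ger0_norm; last by rewrite mulr_ge0// addr_ge0.
rewrite [leRHS]ger0_norm; last by rewrite addr_ge0 ?mulr_ge0// addr_ge0// mulr_ge0// weight_ge0.
rewrite [2 * _]mulrC -!mulrDr; apply: ler_wpM2l => //.
exact: weight_bound_le.
Qed.

End weight_integrability.

(** * Averages of the multiplier as integrals against the weight *)

Section averaged_weight.
Context {R : realType}.
Local Notation mu := (@lebesgue_measure R).
Implicit Types (k G h : R -> R) (z xi w : R).

Lemma ae_eq_Rintegral (f g : R -> R) : measurable_fun [set: R] f ->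
  measurable_fun [set: R] g -> {ae mu, forall x, f x = g x} ->
  \int[mu]_x f x = \int[mu]_x g x.
Proof.
move=> mf mg fg; rewrite /Rintegral; congr fine; apply: ae_eq_integral => //.
- exact/measurable_EFinP.
- exact/measurable_EFinP.
- move: fg; apply: filterS; first exact: (ae_filter_ringOfSetsType mu).
  by move=> x e _; rewrite e.
Qed.

Lemma integrable_weight_section gam z : window gam ->
  mu.-integrable [set: R] (EFin \o (fun xi => gam xi * weight z xi)).
Proof.
move=> [mg g0 _ ig].
have := integrableZr measurableT (weight_bound z) ig.
apply: le_integrable => //.
  apply/measurable_EFinP; apply: measurable_funM => //.
  exact: (measurableT_comp (@measurable_weight R) (@pair1_measurable _ _ _ _ z)).
move=> xi _; rewrite /= lee_fin ger0_norm ?mulr_ge0 ?weight_ge0//.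
by rewrite (le_trans _ (ler_norm _))// ler_wpM2l// weight_le.
Qed.

Lemma window_scaled gam (k a : R) : 0 < k -> window gam ->
  window (fun xi => k * gam (k * (xi - a))).
Proof.
move=> k0 [mg g0 [B gB] ig].
have e : (fun xi => k * gam (k * (xi - a))) = (fun xi => k * gam (k * xi + (- (k * a)))).
  by apply/funext => xi; rewrite mulrBr.
rewrite e; split.
- apply: measurable_funM => //; exact: (measurableT_comp mg (measurable_affine k _)).
- by move=> t; rewrite mulr_ge0// ltW.
- by exists (k * B) => t; rewrite ler_pM2l.
- have := integrableZl measurableT k (integrable_affine (- (k * a)) (lt0r_neq0 k0) ig).
  exact.
Qed.

(** The signed form of the same changes of variables. Fubini is justified by [tonelli_weight] for
    the majorant [G]: the double integral is at most the mass of the scaled window times the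
    integral of [G * weight_bound]. *)
Lemma Rintegral_averaged h G gam (a k : R) : measurable_fun [set: R] h ->
  measurable_fun [set: R] G -> (forall z, `|h z| <= G z) ->
  mu.-integrable [set: R] (EFin \o G) ->
  mu.-integrable [set: R] (EFin \o (fun z => G z * weight_bound z)) ->
  window gam -> 0 < k ->
  \int[mu]_w (\int[mu]_y (k * gam (k * y) * (beta w * h (beta w * (y + (a - w)))))) =
  \int[mu]_z (h z * \int[mu]_y (gam y * weight z (a + y / k))).
Proof.
move=> mh mG hG iG iGw wg k0; have kn := lt0r_neq0 k0.
pose ga xi := k * gam (k * (xi - a)).
have wga : window ga by exact: window_scaled.
have [mga ga0 [B gaB] iga] := wga.
have G0 z : 0 <= G z by exact: le_trans (hG z).
have mgaw : measurable_fun [set: R * R] (fun p => ga ((1 + `|p.1|) * p.2 + p.1)).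
  apply: (measurableT_comp mga); apply: measurable_funD => //; apply: measurable_funM => //.
  by apply: measurable_funD => //; exact: measurableT_comp.
pose f (p : R * R) := ga ((1 + `|p.1|) * p.2 + p.1) * h p.2.
have mf : measurable_fun [set: R * R] f.
  apply: measurable_funM => //.
  exact: (measurableT_comp mh (@measurable_snd _ _ _ _)).
have mfs z : measurable_fun [set: R] (fun w => ga ((1 + `|w|) * z + w)).
  apply: (measurableT_comp mga); apply: measurable_funD => //; apply: measurable_funM => //.
  by apply: measurable_funD => //; exact: measurableT_comp.
have ifw w : mu.-integrable [set: R] (EFin \o (fun z => f (w, z))).
  have := integrableZl measurableT B iG; apply: le_integrable => //.
    apply/measurable_EFinP; apply: measurable_funM => //.
    exact: (measurableT_comp mga (measurable_affine (1 + `|w|) w)).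
  move=> z _; rewrite /= lee_fin /f /= normrM (ger0_norm (ga0 _)).
  by rewrite (le_trans _ (ler_norm _))// ler_pM.
transitivity (\int[mu]_w (\int[mu]_z f (w, z))).
  apply: eq_Rintegral => w _; have b0 := beta_gt0 w; have bn := lt0r_neq0 b0.
  have e := Rintegral_affine (beta w * (a - w)) bn (ifw w).
  have -> : \int[mu]_z f (w, z) = beta w * \int[mu]_x f (w, beta w * x + beta w * (a - w)).
    by rewrite e gtr0_norm// mulrA mulfV// mul1r.
  rewrite -RintegralZl//; last exact: (integrable_affine (beta w * (a - w)) bn (ifw w)).
  apply: eq_Rintegral => y _; rewrite /f /= -mulrDr mulrCA; congr (_ * (k * gam _ * _)).
  by congr (k * _); rewrite mulrA mulfV ?mul1r//; ring.
have pf : (mu \x mu)%E.-integrable [set: R * R] (EFin \o f).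
  apply: integrable_prod_ge0 => //.
  apply: (@le_lt_trans _ _ (\int[mu]_w \int[mu]_z (ga ((1 + `|w|) * z + w)%R * G z)%:E)%E).
    have maf : measurable_fun [set: R * R] (fun p => `|f p|%:E).
      by apply/measurable_EFinP; exact: measurableT_comp.
    have mgG : measurable_fun [set: R * R] (fun p => (ga ((1 + `|p.1|) * p.2 + p.1)%R * G p.2)%:E).
      apply/measurable_EFinP; apply: measurable_funM => //.
      exact: (measurableT_comp mG (@measurable_snd _ _ _ _)).
    apply: ge0_le_integral => //.
    - by move=> w _; exact: integral_ge0.
    - by apply: (measurable_fun_fubini_tonelli_F (m2 := mu) _ maf).
    - apply: (measurable_fun_fubini_tonelli_F (m2 := mu) _ mgG) => p.
      by rewrite lee_fin mulr_ge0.
    - move=> w _; apply: ge0_le_integral => //.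
      + by apply: (measurableT_comp maf (@pair1_measurable _ _ _ _ w)).
      + by apply: (measurableT_comp mgG (@pair1_measurable _ _ _ _ w)).
      + move=> z _; rewrite lee_fin /f /= normrM (ger0_norm (ga0 _)).
        exact: ler_wpM2l.
  rewrite tonelli_weight//.
  have gafin : (\int[mu]_t (ga t)%:E)%E \is a fin_num by exact: integrable_fin_num.
  apply: (@le_lt_trans _ _ (\int[mu]_z ((fine (\int[mu]_t (ga t)%:E))%:E *
    (G z * weight_bound z)%:E))%E).
    have mGk : measurable_fun [set: R * R] (fun p => (G p.1 * (ga p.2 * weight p.1 p.2))%:E).
      apply/measurable_EFinP; apply: measurable_funM.
        exact: (measurableT_comp mG (@measurable_fst _ _ _ _)).
      apply: measurable_funM; last exact: measurable_weight.
      exact: (measurableT_comp mga (@measurable_snd _ _ _ _)).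
    have Gk0 p : (0 <= (G p.1 * (ga p.2 * weight p.1 p.2))%:E)%E.
      by rewrite lee_fin mulr_ge0// mulr_ge0// weight_ge0.
    apply: ge0_le_integral => //.
    - by move=> z _; apply: integral_ge0 => x _; exact: (Gk0 (z, x)).
    - exact: (measurable_fun_fubini_tonelli_F (m2 := mu) _ mGk Gk0).
    - by apply: emeasurable_funM => //; exact: measurable_int iGw.
    - move=> z _; rewrite (fineK gafin).
      rewrite muleC -ge0_integralZl//=; first last.
      + by rewrite lee_fin mulr_ge0// addr_ge0.
      + by move=> t _; rewrite lee_fin.
      + exact/measurable_EFinP.
      apply: ge0_le_integral => //.
      + by move=> x _; exact: (Gk0 (z, x)).
      + by apply: (measurableT_comp mGk (@pair1_measurable _ _ _ _ z)).
      + by apply: emeasurable_funM => //; exact/measurable_EFinP.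
      + move=> x _; rewrite -EFinM lee_fin -[leRHS]mulrA; apply: ler_wpM2l => //.
        by rewrite [leLHS]mulrC; apply: ler_wpM2r => //; exact: weight_le.
  rewrite integralZl// lte_mul_pinfty// ?lee_fin ?fine_ge0// ?integral_ge0//.
  - by move=> t _; rewrite lee_fin.
  - exact: integrable_lty.
rewrite Rintegral_fubini//.
have mga2 z : measurable_fun [set: R] (fun y => gam y * weight z (a + y / k)).
  case: wg => mgam _ _ _; apply: measurable_funM => //.
  apply: (measurableT_comp (f := weight z)).
    exact: (measurableT_comp (@measurable_weight R) (@pair1_measurable _ _ _ _ z)).
  by apply: measurable_funD => //; exact: measurable_funM.
apply: ae_eq_Rintegral.
- have mfC : measurable_fun [set: R * R] (fun p : R * R => f (p.2, p.1)).
    by apply: (measurableT_comp mf); exact: measurable_swap.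
  exact: (measurable_Rintegral_snd mfC).
- apply: measurable_funM => //.
  have mgw : measurable_fun [set: R * R] (fun p => gam p.2 * weight p.1 (a + p.2 / k)).
    case: wg => mgam _ _ _; apply: measurable_funM.
      exact: (measurableT_comp mgam (@measurable_snd _ _ _ _)).
    apply: (measurableT_comp (@measurable_weight R) (f := fun p : R * R => weight p.1 p.2)
      (g := fun p : R * R => (p.1, a + p.2 / k))).
    apply: measurable_fun_pair => //; apply: measurable_funD => //; exact: measurable_funM.
  exact: (measurable_Rintegral_snd mgw).
have := ae_integral_weight mga ga0.
apply: filterS; first exact: (ae_filter_ringOfSetsType mu).
move=> z e; rewrite /f /=.
have iz := integrable_weight_section z wga.
have igz : mu.-integrable [set: R] (EFin \o (fun w => ga ((1 + `|w|) * z + w))).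
  apply/integrableP; split; first by apply/measurable_EFinP; exact: mfs.
  under eq_integral do rewrite /= ger0_norm//.
  by rewrite e; exact: integrable_lty iz.
rewrite RintegralZr// mulrC; congr (_ * _).
transitivity (\int[mu]_xi (ga xi * weight z xi)).
  by rewrite /Rintegral e.
have ig2 : mu.-integrable [set: R] (EFin \o (fun y => gam y * weight z (a + y / k))).
  have [mgam g0 _ ig] := wg.
  have := integrableZr measurableT (weight_bound z) ig.
  apply: le_integrable => //; first by apply/measurable_EFinP; exact: mga2.
  move=> xi _; rewrite /= lee_fin ger0_norm ?mulr_ge0 ?weight_ge0//.
  by rewrite (le_trans _ (ler_norm _))// ler_wpM2l// weight_le.
have e2 := Rintegral_affine (- (k * a)) kn ig2.
have -> : \int[mu]_y (gam y * weight z (a + y / k)) =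
    k * \int[mu]_x (gam (k * x + - (k * a)) * weight z (a + (k * x + - (k * a)) / k)).
  by rewrite e2 gtr0_norm// mulrA mulfV// mul1r.
rewrite -RintegralZl//; last exact: (integrable_affine (- (k * a)) kn ig2).
apply: eq_Rintegral => x _; rewrite /ga -mulrA mulrBr; congr (_ * (_ * weight _ _)).
by field.
Qed.

End averaged_weight.

(** * Convergence of the averages *)

Section weight_limit.
Context {R : realType}.
Local Notation mu := (@lebesgue_measure R).
Implicit Types (k G h : R -> R) (z xi w a : R).

(** The weight depends on [xi] only through the sign of [xi - z]. Hence for fixed [a] the single
    value [z = a], a null set, is lost in the limit. *)
Lemma weight_locally_cst z a xi : `|xi - a| < `|a - z| -> weight z xi = weight z a.
Proof.
move=> xa; rewrite /weight; have [za|az|e] := ltgtP z a; last 1 first.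
- by move: xa; rewrite e subrr normr0 normr_lt0.
- have az0 : 0 < a - z by rewrite subr_gt0.
  have xz0 : 0 < xi - z.
    move: xa; rewrite (gtr0_norm az0) ltr_norml => /andP[]; lra.
  by rewrite !pmulr_rge0// !pmulr_rlt0.
- have az0 : a - z < 0 by rewrite subr_lt0.
  have xz0 : xi - z < 0.
    move: xa; rewrite (ltr0_norm az0) ltr_norml => /andP[]; lra.
  by rewrite !nmulr_rge0// !nmulr_rlt0.
Qed.

Lemma weight_cvg z a y : z != a -> weight z (a + y / n.+1%:R) @[n --> \oo] --> weight z a.
Proof.
move=> za; apply: cvg_near_cst.
have yn : y / n.+1%:R @[n --> \oo] --> 0.
  by rewrite -(mulr0 y); apply: cvgMr; exact: cvg_harmonic.
have az : 0 < `|a - z| by rewrite normr_gt0 subr_eq0 eq_sym.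
move/cvgr0Pnorm_lt : yn => /(_ _ az).
apply: filterS => n yn; apply: weight_locally_cst.
by rewrite addrAC subrr add0r.
Qed.

Lemma dominated_Rintegral (f_ : nat -> R -> R) (f g : R -> R) :
  (forall n, measurable_fun [set: R] (f_ n)) -> measurable_fun [set: R] f ->
  {ae mu, forall z, f_ n z @[n --> \oo] --> f z} ->
  mu.-integrable [set: R] (EFin \o g) ->
  (forall n z, `|f_ n z| <= g z) ->
  \int[mu]_z f_ n z @[n --> \oo] --> \int[mu]_z f z.
Proof.
move=> mf_ mf cf ig fg.
have mE n : measurable_fun [set: R] (fun z => (f_ n z)%:E) by exact/measurable_EFinP.
have mEf : measurable_fun [set: R] (fun z => (f z)%:E) by exact/measurable_EFinP.
have cE : {ae mu, forall z, [set: R] z -> (f_ n z)%:E @[n --> \oo] --> (f z)%:E}.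
  move: cf; apply: filterS; first exact: (ae_filter_ringOfSetsType mu).
  by move=> z cz _; exact: cvg_EFin (nearW _ _) cz.
have dE : {ae mu, forall z, forall n, [set: R] z -> (`|(f_ n z)%:E| <= (EFin \o g) z)%E}.
  by apply: aeW => z n _; rewrite lee_fin.
have [iF _ cI] := @dominated_convergence _ _ _ mu setT measurableT _ _ _ mE mEf cE ig dE.
have fin : (\int[mu]_z (f z)%:E)%E \is a fin_num by exact: integrable_fin_num.
by rewrite -[X in _ --> X]/(fine (\int[mu]_z (f z)%:E)%E); apply: fine_cvg; rewrite fineK.
Qed.

End weight_limit.

(** * A constant multiplier vanishes *)

Section constant_weighted_integral.
Context {R : realType}.
Local Notation mu := (@lebesgue_measure R).
Implicit Types (k G h : R -> R) (z xi w a : R).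

Lemma measurable_weight1 xi : measurable_fun [set: R] (fun z => weight z xi).
Proof. exact: (measurableT_comp (@measurable_weight R) (@pair2_measurable _ _ _ _ xi)). Qed.

Lemma normr_weightM_le h G z xi : `|h z| <= G z -> `|h z * weight z xi| <= G z * weight_bound z.
Proof.
move=> hG; rewrite normrM (ger0_norm (weight_ge0 z xi)).
by apply: ler_pM => //; [exact: weight_ge0|exact: weight_le].
Qed.

(** Dominated convergence is used twice: in [y] with majorant [weight_bound z * gam y], then in [z]
    with majorant [G * weight_bound] times the mass of [gam]. *)
Lemma Rintegral_weight_eq h G gam c a : measurable_fun [set: R] h ->
  measurable_fun [set: R] G -> (forall z, `|h z| <= G z) ->
  mu.-integrable [set: R] (EFin \o (fun z => G z * weight_bound z)) ->
  window gam ->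
  (forall n, \int[mu]_z (h z * \int[mu]_y (gam y * weight z (a + y / n.+1%:R))) = c) ->
  (\int[mu]_y gam y) * \int[mu]_z (h z * weight z a) = c.
Proof.
move=> mh mG hG iGw wg hc; have [mg g0 _ ig] := wg.
pose I := \int[mu]_y gam y.
pose Phi n z := \int[mu]_y (gam y * weight z (a + y / n.+1%:R)).
have mgw n : measurable_fun [set: R * R] (fun p => gam p.2 * weight p.1 (a + p.2 / n.+1%:R)).
  apply: measurable_funM.
    exact: (measurableT_comp mg (@measurable_snd _ _ _ _)).
  apply: (measurableT_comp (@measurable_weight R) (f := fun p : R * R => weight p.1 p.2)
    (g := fun p : R * R => (p.1, a + p.2 / n.+1%:R))).
  by apply: measurable_fun_pair => //; apply: measurable_funD => //; exact: measurable_funM.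
have mgw1 n z : measurable_fun [set: R] (fun y => gam y * weight z (a + y / n.+1%:R)).
  exact: (measurableT_comp (mgw n) (@pair1_measurable _ _ _ _ z)).
have mPhi n : measurable_fun [set: R] (Phi n) by exact: (measurable_Rintegral_snd (mgw n)).
have gwb n z y : `|gam y * weight z (a + y / n.+1%:R)| <= weight_bound z * gam y.
  rewrite normrM (ger0_norm (g0 y)) ger0_norm ?weight_ge0// [leRHS]mulrC.
  by apply: ler_wpM2l => //; exact: weight_le.
have iwg z : mu.-integrable [set: R] (EFin \o (fun y => weight_bound z * gam y)).
  exact: (integrableZl measurableT (weight_bound z) ig).
have Phile n z : `|Phi n z| <= weight_bound z * I.
  have i1 : mu.-integrable [set: R] (EFin \o (fun y => gam y * weight z (a + y / n.+1%:R))).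
    apply: le_integrable (iwg z) => //; first by apply/measurable_EFinP; exact: mgw1.
    by move=> y _; rewrite /= lee_fin (le_trans _ (ler_norm _)).
  apply: (le_trans (le_normr_Rintegral measurableT i1)).
  rewrite -RintegralZl//; apply: le_Rintegral => //; exact: integrable_norm.
have Phicvg z : z != a -> Phi n z @[n --> \oo] --> I * weight z a.
  move=> za; have -> : I * weight z a = \int[mu]_y (gam y * weight z a) by rewrite RintegralZr.
  apply: (@dominated_Rintegral _ _ _ (fun y => weight_bound z * gam y)) => //.
  - by apply: measurable_funM.
  - by apply: aeW => y; apply: cvgMr; exact: weight_cvg.
have lim : \int[mu]_z (h z * Phi n z) @[n --> \oo] --> \int[mu]_z (h z * (I * weight z a)).
  apply: (@dominated_Rintegral _ _ _ (fun z => I * (G z * weight_bound z))).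
  - by move=> n; exact: measurable_funM.
  - by apply: measurable_funM => //; apply: measurable_funM => //; exact: measurable_weight1.
  - have := ae_neq a; apply: filterS; first exact: (ae_filter_ringOfSetsType mu).
    by move=> z za; apply: cvgMr; exact: Phicvg.
  - exact: (integrableZl measurableT I iGw).
  - move=> n z; rewrite normrM mulrCA [I * _]mulrC.
    by apply: ler_pM.
have cst : \int[mu]_z (h z * Phi n z) @[n --> \oo] --> c.
  by under eq_cvg do rewrite hc; exact: cvg_cst.
have <- : \int[mu]_z (h z * (I * weight z a)) = c by exact: (cvg_unique _ lim cst).
rewrite -RintegralZl//; first by apply: eq_Rintegral => z _; rewrite mulrCA.
apply: le_integrable iGw => //.
  by apply/measurable_EFinP; apply: measurable_funM => //; exact: measurable_weight1.
by move=> z _; rewrite /= lee_fin (le_trans (normr_weightM_le _ (hG z)))// ler_norm.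
Qed.

(* As functions of [xi], both terms of [weight z xi] jump at [xi = z] only. *)
Lemma weightE z xi : z != xi -> weight z xi =
  ((if z < - 1 then `|1 + z|^-1 else 0) + (if z < 1 then `|1 - z|^-1 else 0)) +
  (if z <= xi then (1 + z)^-1 + (z - 1)^-1 else 0).
Proof.
move=> zxi.
have s1 : (if 0 <= (xi - z) * (1 + z) then `|1 + z|^-1 else 0) =
    (if z < - 1 then `|1 + z|^-1 else 0) + (if z <= xi then (1 + z)^-1 else 0).
  have [z1|z1|z1] := ltgtP z (- 1).
  - have n1 : 1 + z < 0 by lra.
    rewrite nmulr_lge0// subr_le0 ltr0_norm// invrN.
    have [?|?|e] := ltgtP z xi; [by rewrite addNr|by rewrite addr0|by rewrite e eqxx in zxi].
  - have n1 : 0 < 1 + z by lra.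
    rewrite pmulr_lge0// subr_ge0 gtr0_norm// add0r.
    by have [?|?|e] := ltgtP z xi.
  (* At [z = -1] both sides are 0 by the convention that the inverse of 0 is 0; the case [z = 1]
     below is the same. *)
  - have -> : 1 + z = 0 by rewrite z1 subrr.
    by rewrite normr0 invr0 !if_same addr0.
have s2 : (if (xi - z) * (1 - z) < 0 then `|1 - z|^-1 else 0) =
    (if z < 1 then `|1 - z|^-1 else 0) + (if z <= xi then (z - 1)^-1 else 0).
  have [z1|z1|z1] := ltgtP z 1.
  - have n1 : 0 < 1 - z by lra.
    rewrite pmulr_llt0// subr_lt0 gtr0_norm//.
    have e1 : (z - 1)^-1 = - (1 - z)^-1 by rewrite -invrN opprB.
    have [?|?|e] := ltgtP z xi; [by rewrite e1 subrr|by rewrite addr0|by rewrite e eqxx in zxi].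
  - have n1 : 1 - z < 0 by lra.
    rewrite nmulr_llt0// subr_gt0 ltr0_norm// opprB add0r.
    by have [?|?|e] := ltgtP z xi; [|by []|by rewrite e eqxx in zxi].
  - by rewrite z1 subrr normr0 invr0 !if_same addr0.
by rewrite /weight s1 s2 addrACA; case: (z <= xi); rewrite ?addr0.
Qed.

(** By [weightE] the integral at [a] is a term independent of [a] plus the indefinite integral, from
    minus infinity to [a], of [h] times the jump. Constancy in [a] forces this product to vanish
    almost everywhere. *)
Lemma Rintegral_weight_cst0 h G c : measurable_fun [set: R] h ->
  measurable_fun [set: R] G -> (forall z, `|h z| <= G z) ->
  mu.-integrable [set: R] (EFin \o (fun z => G z * weight_bound z)) ->
  (forall a, \int[mu]_z (h z * weight z a) = c) -> c = 0.
Proof.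
move=> mh mG hG iGw hc.
pose C0 z : R := (if z < - 1 then `|1 + z|^-1 else 0) + (if z < 1 then `|1 - z|^-1 else 0).
pose D0 z : R := (1 + z)^-1 + (z - 1)^-1.
pose g z := h z * D0 z.
have C0le z : `|C0 z| <= weight_bound z.
  by rewrite ger0_norm; [apply: lerD; case: ifP|rewrite addr_ge0//; case: ifP].
have D0le z : `|D0 z| <= weight_bound z.
  by rewrite (le_trans (ler_normD _ _))// !normfV (distrC z).
(* The signed inverse is written as [f] times the square of the inverse of its absolute value, which
   also holds at the zeros of [f]. *)
have mV (f : R -> R) : measurable_fun [set: R] f -> measurable_fun [set: R] (fun z => (f z)^-1).
  move=> mf; rewrite (_ : (fun z => _) = (fun z => f z * (`|f z|^-1 * `|f z|^-1))); last first.
    apply/funext => z; have [->|f0] := eqVneq (f z) 0; first by rewrite invr0 mul0r.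
    rewrite -invfM -normrM ger0_norm ?sqr_ge0// -expr2 ?sqr_ge0//.
    by rewrite expr2 invfM mulrA mulfV// mul1r.
  by apply: measurable_funM => //; apply: measurable_funM; exact: measurable_normrV.
have m1 : measurable_fun [set: R] (fun z : R => 1 + z) by exact: measurable_funD.
have m2 : measurable_fun [set: R] (fun z : R => 1 - z) by exact: measurable_funB.
have m3 : measurable_fun [set: R] (fun z : R => z - 1) by exact: measurable_funB.
have mC0 : measurable_fun [set: R] C0.
  apply: measurable_funD; apply: measurable_fun_ifT => //.
  - exact: measurable_fun_ltr.
  - exact: measurable_normrV.
  - exact: measurable_fun_ltr.
  - exact: measurable_normrV.
have mD0 : measurable_fun [set: R] D0 by apply: measurable_funD; exact: mV.
have dom (f : R -> R) : measurable_fun [set: R] f -> (forall z, `|f z| <= weight_bound z) ->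
    mu.-integrable [set: R] (EFin \o (fun z => h z * f z)).
  move=> mf fw; apply: le_integrable iGw => //.
    by apply/measurable_EFinP; exact: measurable_funM.
  move=> z _; rewrite /= lee_fin (le_trans _ (ler_norm _))// normrM.
  by apply: ler_pM.
have iC := dom _ mC0 C0le; have ig := dom _ mD0 D0le.
have igr (a : R) : mu.-integrable [set: R] (EFin \o (g \_ `]-oo, a])).
  have ma : measurable (`]-oo, a]%classic : set R) by exact: measurable_itv.
  rewrite -restrict_EFin; apply: (proj1 (@integrable_mkcond _ _ _ mu _ (EFin \o g) ma)).
  by apply: (integrableS (mu := mu) measurableT).
have mitv (a : R) : measurable (`]-oo, a]%classic : set R) by exact: measurable_itv.
have me a : \int[mu]_z (h z * weight z a) =
    \int[mu]_z (h z * C0 z) + \int[mu]_(z in `]-oo, a]) g z.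
  rewrite [X in _ + X]Rintegral_mkcond -RintegralD//.
  apply: ae_eq_Rintegral.
  - by apply: measurable_funM => //; exact: measurable_weight1.
  - apply: measurable_funD; apply/measurable_EFinP.
      exact: measurable_int iC.
    exact: measurable_int (igr a).
  - have := ae_neq a; apply: filterS; first exact: (ae_filter_ringOfSetsType mu).
    move=> z za; rewrite weightE// mulrDr; congr (_ + _); rewrite patchE mem_setE in_itv/=.
    by case: ifP => // _; rewrite mulr0.
have Fcst : (fun x => \int[mu]_(z in `]-oo, x]) g z) = cst (c - \int[mu]_z (h z * C0 z)).
  by apply/funext => x; rewrite /= -(hc x) me addrC addKr.
(* The derivative of the indefinite integral is [g] almost everywhere, and it is 0 because that
   integral is constant. *)
have : {ae mu, forall x : R, g x = 0}.
  have igs y : mu.-integrable (`]-oo, y]%classic : set R) (EFin \o g).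
    by apply: (integrableS measurableT) => //.
  have lg : locally_integrable [set: R] g by apply: open_integrable_locally => //; exact: openT.
  have := FTC1Ny igs lg; rewrite /= Fcst.
  apply: filterS; first exact: (ae_filter_ringOfSetsType mu).
  by move=> x [_ <-]; rewrite derive1_cst.
move=> g0; rewrite -(hc 0).
have -> : \int[mu]_z (h z * weight z 0) = \int[mu]_(z in [set: R]) (0 : R).
  apply: ae_eq_Rintegral.
  - by apply: measurable_funM => //; exact: measurable_weight1.
  - exact: measurable_cst.
  - have zN : {ae mu, forall z : R, z != 1 /\ z != - 1}.
      have := ae_neq (1 : R); have := ae_neq (- 1 : R).
      by apply: filterS2; first exact: (ae_filter_ringOfSetsType mu).
    have := ae_neq (0 : R); move: g0 zN.
    apply: filterS3; first exact: (ae_filter_ringOfSetsType mu).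
    move=> z /eqP + [z1 zN1] z0; rewrite mulf_eq0 => /orP[/eqP ->|/eqP D0z]; first by rewrite mul0r.
    have a1 : 1 + z != 0 by apply: contra zN1 => /eqP e; apply/eqP; lra.
    have a2 : z - 1 != 0 by rewrite subr_eq0.
    (* The jump is 2z / ((1 + z)(z - 1)); away from [0], [1] and [-1] it is nonzero, so the
       vanishing factor must be [h z]. *)
    have : D0 z * ((1 + z) * (z - 1)) = 2 * z by rewrite /D0; field; rewrite a1 a2.
    by rewrite D0z mul0r => /esym/eqP; rewrite mulf_eq0 (negbTE z0) pnatr_eq0.
by rewrite Rintegral_cst// mul0r.
Qed.

End constant_weighted_integral.

(** * The approximate identity *)

Section test_window.
Context {R : realType}.
Local Notation mu := (@lebesgue_measure R).

(** The profile of the approximate identity: the case [k = 1] of the product of a transform pair's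
    weights in the tested identity. *)
Definition test_window (y : R) := laplace 1 y * poisson 1 y.

Lemma test_window_gt0 y : 0 < test_window y.
Proof.
rewrite mulr_gt0 ?expR_gt0// /poisson divr_gt0// ?mulr_gt0//.
by rewrite ltr_wpDr ?sqr_ge0// expr1n.
Qed.

Lemma window_test_window : window test_window.
Proof.
have [ml l0 _ il] := window_laplace (ltr01 : (0 : R) < 1).
have [mp p0 _ _] := window_poisson (ltr01 : (0 : R) < 1).
have p2 (y : R) : poisson 1 y <= 2 by rewrite (le_trans (poisson_le _ ltr01))// divr1.
have l1 (y : R) : laplace 1 y <= 1.
  by rewrite -[leRHS]expR0 ler_expR mul1r oppr_le0.
split.
- exact: measurable_funM.
- by move=> y; exact: ltW (test_window_gt0 y).
- exists (1 * 2) => y; exact: ler_pM.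
- have := integrableZr measurableT 2 il; apply: le_integrable => //.
    by apply/measurable_EFinP; exact: measurable_funM.
  move=> y _; rewrite /= lee_fin (ger0_norm (ltW (test_window_gt0 y))).
  by rewrite (le_trans _ (ler_norm _))// ler_wpM2l.
Qed.

Lemma Rintegral_test_window_neq0 : \int[mu]_y test_window y != 0.
Proof.
have [mg g0 _ ig] := window_test_window.
apply/eqP => I0.
have E0 : (\int[mu]_y `|(test_window y)%:E| = 0)%E.
  under eq_integral do rewrite gee0_abs ?lee_fin//.
  have fin : (\int[mu]_y (test_window y)%:E)%E \is a fin_num by exact: integrable_fin_num.
  by rewrite -[LHS](fineK fin); congr EFin; exact: I0.
have mE : measurable_fun [set: R] (EFin \o test_window) by exact/measurable_EFinP.
have := proj1 (ae_eq_integral_abs mu measurableT mE) E0.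
move=> ae0.
have : {ae mu, forall y, test_window y = 0}.
  by move: ae0; apply: filterS => y /= /(_ I) [].
move=> /(ae_exists_itv ltr01)[y _ y0].
by have := test_window_gt0 y; rewrite y0 ltxx.
Qed.

(** This is the reason for the reciprocal parameters: both factors have width proportional to
    [1 / k], so their product is an exact dilate of one fixed profile. *)
Lemma laplace_poisson_scale (k y : R) : 0 < k ->
  laplace k y * poisson k^-1 y = k * test_window (k * y).
Proof.
move=> k0; rewrite /test_window /laplace mul1r normrM (gtr0_norm k0) [RHS]mulrCA.
congr (_ * _); rewrite /poisson.
have kn := lt0r_neq0 k0.
have d1 : 1 ^+ 2 + (2 * pi * (k * y)) ^+ 2 != 0.
  by rewrite gt_eqF// ltr_wpDr ?sqr_ge0// expr1n.
have e : k^-1 ^+ 2 + (2 * pi * y) ^+ 2 = k ^- 2 * (1 ^+ 2 + (2 * pi * (k * y)) ^+ 2).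
  by field.
by rewrite e; move: (1 ^+ 2 + _) d1 => D D0; field; rewrite D0 kn.
Qed.

(** The same scaling, with [k^-1] for [k]. The right-hand side of the tested identity is thus
    independent of [k] and equals the mass of the approximate identity, which normalizes the
    multiplier to 1. *)
Lemma Rintegral_poisson_laplace (k : R) : 0 < k ->
  \int[mu]_t (poisson k t * laplace k^-1 t) = \int[mu]_y test_window y.
Proof.
move=> k0; have [_ _ _ ig] := window_test_window.
have kV0 : 0 < k^-1 by rewrite invr_gt0.
have := Rintegral_affine 0 (lt0r_neq0 kV0) ig.
rewrite gtr0_norm// invrK => e.
have -> : \int[mu]_y test_window y = k^-1 * \int[mu]_x test_window (k^-1 * x + 0).
  by rewrite e mulrA mulVf ?mul1r// gt_eqF.
rewrite -RintegralZl//; last exact: (integrable_affine 0 (lt0r_neq0 kV0) ig).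
apply: eq_Rintegral => t _; rewrite addr0 -laplace_poisson_scale// invrK.
by rewrite mulrC.
Qed.

End test_window.

Theorem proposition8 (R : realType) :
  ~ exists psi phi : R -> R[i],
    [/\ cLp 2 psi,
        cLp 2 phi,
        reproducing_pair (atom psi) (atom phi),
        exists psihat phihat : R -> R[i],
          [/\ is_fourier2 psi psihat,
              is_fourier2 phi phihat &
              {ae @lebesgue_measure R, forall xi : R,
                (\int[@lebesgue_measure R]_w
                   (Normc.normc (psihat (beta w * (xi - w))
                                 * phihat (beta w * (xi - w)))
                    * beta w)%:E < +oo)%E}] &
        exists S : (R -> R[i]) -> (R -> R[i]),
          is_resolution_operator (atom psi) (atom phi) S /\
          (forall f : R -> R[i], cLp 2 f -> aeeq (S f) f)].
Proof.
move=> [psi [phi [_ _ _ [psihat [phihat [F2 F2' hM]]] [S [resS Sid]]]]].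
have [_ mpsih _ psihoo _] := is_fourier2_approx F2.
have [_ mphih _ phihoo _] := is_fourier2_approx F2'.
pose G z := normc (psihat z * phihat z).
(* The real part suffices, because the tested identities have real right-hand sides. *)
pose h z := complex.Re (conjc (psihat z) * phihat z).
have mh : measurable_fun [set: R] h.
  by have [] := cmeasurableM (cmeasurable_conj mpsih) mphih.
have mG : measurable_fun [set: R] G.
  by apply: cmeasurable_normc; exact: cmeasurableM.
have hG z : `|h z| <= G z.
  by rewrite (le_trans (normr_Re_le _))// Normc.normcM normc_conj -Normc.normcM.
have iG : (@lebesgue_measure R).-integrable [set: R] (EFin \o G).
  exact: integrable_normc (cintegrableM mpsih mphih psihoo phihoo).
(* Here the finiteness condition on the transforms enters. *)
have iGw := integrable_weight_bound mG (fun z => normc_ge0 _) iG hM.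
have wg := window_test_window (R := R).
(* The averages of the multiplier around [a] have the same value at every scale [k]. *)
have avg (a k : R) : 0 < k ->
    \int[@lebesgue_measure R]_z (h z * \int[@lebesgue_measure R]_y
      (test_window y * weight z (a + y / k))) = \int[@lebesgue_measure R]_y test_window y.
  move=> k0; rewrite -(Rintegral_averaged a mh mG hG iG iGw wg k0).
  rewrite -(Rintegral_poisson_laplace k0) -(resolution_identity a k0 F2 F2' resS Sid).
  by apply: eq_Rintegral => w _; apply: eq_Rintegral => y _; rewrite laplace_poisson_scale.
(* The limit at scales [n.+1] gives the mass of the window times the multiplier at [a]; this mass is
   nonzero and cancels. *)
have m1 a : \int[@lebesgue_measure R]_z (h z * weight z a) = 1.
  apply: (mulfI (Rintegral_test_window_neq0 (R := R))); rewrite mulr1.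
  by apply: (Rintegral_weight_eq mh mG hG iGw wg) => n; exact: avg.
have := Rintegral_weight_cst0 mh mG hG iGw m1.
by apply/eqP; rewrite oner_eq0.
Qed.
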